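(* Let $H$ be a Hilbert space over $\mathbf K\in\{\mathbb R,\mathbb C\}$, let $H'$ be its dual, and let $\mathcal S$ be the normed algebra of all finite rank bounded operators on $H$. The normal category $\mathscr R(\mathcal S)$ of principal right ideals of $\mathcal S$ is isomorphic, as a normal category, to the normal category $\mathscr F(H')$ of finite-dimensional subspaces of $H'$, via an isomorphism sending $P_M\mathcal S$ to $M'$. For all finite-dimensional subspaces $M$ and $N$ of $H$, this isomorphism restricts to a normed space isomorphism (linear, bijective, norm-preserving) of the hom-set $\mathscr R(\mathcal S)(P_M\mathcal S,P_N\mathcal S)$ onto the hom-set $\mathscr F(H')(M',N')$.
   Context: Composition convention: operators and morphisms are composed left to right, i.e. $(T_1T_2)(x)=T_2(T_1(x))$, and $fg$ means first $f$, then $g$. $\mathcal S$ carries the operator norm. For a finite-dimensional subspace $M$ of $H$, $P_M$ is the orthogonal projection of $H$ onto $M$, and $M'=\{f_m\in H': m\in M\}$, where $f_m(x)=\langle x,m\rangle$ (inner product linear in the first variable). Every finite-dimensional subspace of $H'$ is $M'$ for a unique finite-dimensional subspace $M$ of $H$. Category $\mathscr R(\mathcal S)$: objects are the principal right ideals $P\mathcal S=\{PA:A\in\mathcal S\}$ with $P\in\mathcal S$ idempotent; every object equals $P_M\mathcal S$ for a unique finite-dimensional subspace $M$ of $H$. Morphisms $P_M\mathcal S\to P_N\mathcal S$ are the maps $\lambda(P_M,T,P_N):A\mapsto TA$ for $T\in P_N\mathcal SP_M$. Inclusions are the set inclusions. Hom-sets are normed spaces with $\lambda(P_M,T_1,P_N)+\lambda(P_M,T_2,P_N)=\lambda(P_M,T_1+T_2,P_N)$,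 $k\lambda(P_M,T,P_N)=\lambda(P_M,kT,P_N)$, $\|\lambda(P_M,T,P_N)\|=\|T\|$. Category $\mathscr F(H')$: objects are the finite-dimensional subspaces of $H'$; morphisms are all linear maps between them; inclusions are subspace inclusions; hom-sets carry the operator norm. A category with subobjects is a small category $\mathscr C$ with a subcategory $\mathscr P$ having the same objects, such that $\mathscr P$ is a strict preorder (at most one morphism between any two objects, and the relation ''there is a morphism $p\to p'$'' is a partial order), every morphism of $\mathscr P$ (called an inclusion) is a monomorphism in $\mathscr C$, and if $f=hg$ with $f,g\in\mathscr P$, $h\in\mathscr C$, then $h\in\mathscr P$. A retraction is a morphism $q$ with $jq=1$ for some inclusion $j$. A normal factorization of $f$ is $f=quj$ with $q$ a retraction, $u$ an isomorphism, $j$ an inclusion. A cone $\gamma$ with vertex $d$ assigns to each object $c$ a morphism $\gamma(c):c\to d$ with $j\gamma(c)=\gamma(c')$ for every inclusion $j:c'\to c$; it is normal if some $\gamma(c)$ is an isomorphism. A normal category is a category with subobjects in which every morphism has a normal factorization, every inclusion splits (has a retraction), and for each object $d$ there is a normal cone $\gamma$ with vertex $d$ and $\gamma(d)=1_d$. Two normal categories are isomorphic if there are mutually inverse inclusion-preserving functors between them. *)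

(* Defs.v *)
From HB Require Import structures.
From mathcomp Require Import all_boot all_order all_algebra.
From mathcomp Require Import complex.
From mathcomp Require Import all_classical all_reals all_analysis.
From mathcomp Require Import ring lra.
Set Implicit Arguments.
Unset Strict Implicit.
Unset Printing Implicit Defensive.
Import Order.TTheory GRing.Theory Num.Theory.
Import numFieldNormedType.Exports.
Local Open Scope classical_set_scope.
Local Open Scope ring_scope.

Inductive scalar_kind := RealScalars | ComplexScalars.

Definition scalars (R : realType) (k : scalar_kind) : numFieldType :=
  match k with RealScalars => R | ComplexScalars => R[i] end.

Definition conj_scalar (R : realType) (k : scalar_kind) : scalars R k -> scalars R k :=
  match k with RealScalars => id | ComplexScalars => @conjc R end.

Definition real_part (R : realType) (k : scalar_kind) : scalars R k -> R :=
  match k with RealScalars => id | ComplexScalars => @complex.Re R end.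

Definition ofR (R : realType) (k : scalar_kind) : R -> scalars R k :=
  match k with RealScalars => id | ComplexScalars => fun x => (x%:C)%C end.

(* [{dot _ for theta}] forms are linear in the first variable. *)
Record hilbertSpace (R : realType) (k : scalar_kind) := HilbertSpace {
  hilbert_sort :> completeNormedModType (scalars R k);
  inner : {dot hilbert_sort for @conj_scalar R k};
  inner_norm : forall x, inner x x = `|x| ^+ 2 }.

Section Scalars.
Variables (R : realType) (k : scalar_kind).
Local Notation K := (scalars R k).
Implicit Types a b : K.

Lemma conj_scalarD a b : conj_scalar (a + b) = conj_scalar a + conj_scalar b.
Proof. by case: k a b => //= a b; rewrite rmorphD. Qed.
Lemma conj_scalarM a b : conj_scalar (a * b) = conj_scalar a * conj_scalar b.
Proof. by case: k a b => //= a b; rewrite rmorphM. Qed.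
Lemma conj_scalarK a : conj_scalar (conj_scalar a) = a.
Proof. by case: k a => //= a; rewrite conjcK. Qed.
Lemma mul_conj_scalar a : a * conj_scalar a = `|a| ^+ 2.
Proof.
case: k a => //= a; first by rewrite -normrX ger0_norm ?sqr_ge0.
by rewrite sqr_normc.
Qed.
Lemma conj_scalar_ge0 a : 0 <= a -> conj_scalar a = a.
Proof.
case: k a => //= -[a b]; rewrite lecE /= => /andP[/eqP -> _].
by rewrite oppr0.
Qed.
Lemma real_partK a : 0 <= a -> ofR k (real_part a) = a.
Proof.
case: k a => //= -[a b]; rewrite lecE /= => /andP[/eqP -> _] //.
Qed.
Lemma ler_ofR (x y : R) : (ofR k x <= ofR k y) = (x <= y).
Proof. by case: k => //=; rewrite lecR. Qed.
Lemma ofRK (x : R) : real_part (ofR k x) = x.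
Proof. by case: k. Qed.
End Scalars.
Lemma linear_eq (R : pzRingType) (U V : lmodType R) (f g : {linear U -> V}) :
  f =1 g -> f = g.
Proof.
case: f => f [[a] [b]]; case: g => g [[c] [d]] /= /funext e.
subst g; congr GRing.Linear.Pack; congr GRing.Linear.Class; congr (_ _); exact: Prop_irrelevance.
Qed.

Section LinearMaps.
Variables (K : comPzRingType) (U V : lmodType K).
Implicit Types f g h : {linear U -> V}.

HB.instance Definition _ := gen_eqMixin {linear U -> V}.
HB.instance Definition _ := gen_choiceMixin {linear U -> V}.

Lemma lin_add_linear f g : linear (fun x => f x + g x).
Proof. by move=> a x y; rewrite !linearP scalerDr addrACA. Qed.
Lemma lin_opp_linear f : linear (fun x => - f x).
Proof. by move=> a x y; rewrite linearP opprD scalerN. Qed.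
Lemma lin_zero_linear : linear (fun _ : U => 0 : V).
Proof. by move=> a x y; rewrite scaler0 addr0. Qed.
Lemma lin_scale_linear (c : K) f : linear (fun x => c *: f x).
Proof. by move=> a x y; rewrite linearP scalerDr !scalerA mulrC. Qed.

Definition mklin (f : U -> V) (fL : linear f) : {linear U -> V} :=
  HB.pack f (GRing.isLinear.Build K U V *:%R f fL).

Definition lin_add f g := mklin (lin_add_linear f g).
Definition lin_opp f := mklin (lin_opp_linear f).
Definition lin_zero := mklin lin_zero_linear.
Definition lin_scale c f := mklin (lin_scale_linear c f).

Let addA : associative lin_add.
Proof. by move=> f g h; apply: linear_eq => x /=; rewrite addrA. Qed.
Let addC : commutative lin_add.
Proof. by move=> f g; apply: linear_eq => x /=; rewrite addrC. Qed.
Let add0 : left_id lin_zero lin_add.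
Proof. by move=> f; apply: linear_eq => x /=; rewrite add0r. Qed.
Let addN : left_inverse lin_zero lin_opp lin_add.
Proof. by move=> f; apply: linear_eq => x /=; rewrite addNr. Qed.

HB.instance Definition _ :=
  GRing.isZmodule.Build {linear U -> V} addA addC add0 addN.

Let scaleA a b f : lin_scale a (lin_scale b f) = lin_scale (a * b) f.
Proof. by apply: linear_eq => x /=; rewrite scalerA. Qed.
Let scale1 : left_id 1 lin_scale.
Proof. by move=> f; apply: linear_eq => x /=; rewrite scale1r. Qed.
Let scaleDr : right_distributive lin_scale +%R.
Proof. by move=> a f g; apply: linear_eq => x /=; rewrite scalerDr. Qed.
Let scaleDl f : {morph lin_scale^~ f : a b / a + b}.
Proof. by move=> a b; apply: linear_eq => x /=; rewrite scalerDl. Qed.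

HB.instance Definition _ := GRing.Zmodule_isLmodule.Build K {linear U -> V}
  scaleA scale1 scaleDr scaleDl.

End LinearMaps.

Section FiniteDimensional.
Variables (K : fieldType) (V : lmodType K).
Implicit Types A B : set V.

Definition spanned_by n (e : 'I_n -> V) : set V :=
  [set x | exists c : 'I_n -> K, x = \sum_i c i *: e i].

Definition findim A := exists n (e : 'I_n -> V), A = spanned_by e.

Definition subspace A := A 0 /\ forall a x y, A x -> A y -> A (a *: x + y).

Lemma spanned_subspace n (e : 'I_n -> V) : subspace (spanned_by e).
Proof.
split; first by exists (fun=> 0); rewrite big1 // => i _; rewrite scale0r.
move=> a _ _ [c ->] [d ->]; exists (fun i => a * c i + d i).
rewrite scaler_sumr -big_split /=; apply: eq_bigr => i _.
by rewrite scalerA scalerDl.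
Qed.

Lemma findim_subspace A : findim A -> subspace A.
Proof. by case=> n [e ->]; exact: spanned_subspace. Qed.

Lemma subspace_sum A (I : Type) (r : seq I) (F : I -> V) (c : I -> K) :
  subspace A -> (forall i, A (F i)) -> A (\sum_(i <- r) c i *: F i).
Proof.
move=> [A0 AL] AF; elim: r => [|i r IH]; first by rewrite big_nil.
by rewrite big_cons; exact: AL.
Qed.

Lemma subspaceD A x y : subspace A -> A x -> A y -> A (x + y).
Proof. by move=> [_ AL] Ax Ay; rewrite -[x]scale1r; exact: AL. Qed.
Lemma subspaceZ A a x : subspace A -> A x -> A (a *: x).
Proof. by move=> [A0 AL] Ax; rewrite -[_ *: _]addr0; exact: AL. Qed.
Lemma subspaceN A x : subspace A -> A x -> A (- x).
Proof. by move=> AL Ax; rewrite -scaleN1r; exact: subspaceZ. Qed.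
Lemma subspaceB A x y : subspace A -> A x -> A y -> A (x - y).
Proof. by move=> AL Ax Ay; apply: subspaceD => //; exact: subspaceN. Qed.

Lemma mem_spanned n (e : 'I_n -> V) i : spanned_by e (e i).
Proof.
exists (fun j => (j == i)%:R); rewrite (bigD1 i) //= eqxx scale1r big1 ?addr0 //.
by move=> j /negbTE ->; rewrite scale0r.
Qed.

Lemma spanned_min n (e : 'I_n -> V) A : subspace A -> (forall i, A (e i)) ->
  spanned_by e `<=` A.
Proof. by move=> AL Ae _ [c ->]; exact: subspace_sum. Qed.

Lemma spanned0 (e : 'I_0 -> V) : spanned_by e = [set 0].
Proof.
apply/seteqP; split => x /=; first by case=> c ->; rewrite big_ord0.
by move=> ->; exists (fun=> 0); rewrite big_ord0.
Qed.

Definition snoc n (e : 'I_n -> V) (v : V) (i : 'I_n.+1) : V :=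
  oapp e v (unlift ord_max i).

Lemma spanned_snoc n (e : 'I_n -> V) v x : spanned_by (snoc e v) x <->
  exists a y, spanned_by e y /\ x = y + a *: v.
Proof.
split.
  case=> c ->; exists (c ord_max), (\sum_i c (lift ord_max i) *: e i).
  split; first by exists (fun i => c (lift ord_max i)).
  rewrite big_ord_recr /=; congr (_ + _); last by rewrite /snoc unlift_none.
  apply: eq_bigr => i _; have -> : widen_ord (leqnSn n) i = lift ord_max i.
    by apply: val_inj; rewrite /= /bump leqNgt ltn_ord.
  by rewrite /snoc liftK.
case=> a [_ [[c ->] ->]].
exists (fun i => oapp c a (unlift ord_max i)); rewrite big_ord_recr /=.
congr (_ + _); last by rewrite /snoc !unlift_none.
apply: eq_bigr => i _; have -> : widen_ord (leqnSn n) i = lift ord_max i.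
  by apply: val_inj; rewrite /= /bump leqNgt ltn_ord.
by rewrite /snoc !liftK.
Qed.

Lemma spanned_recr n (e : 'I_n.+1 -> V) :
  spanned_by e = spanned_by (snoc (fun i => e (lift ord_max i)) (e ord_max)).
Proof.
congr spanned_by; apply/funext => i; rewrite /snoc.
by case: unliftP => [j ->|->].
Qed.

Lemma findim_sub A B : findim B -> subspace A -> A `<=` B -> findim A.
Proof.
case=> n [e ->]; elim: n e A => [|n IH] e A AL AB.
  exists 0%N, e; apply/seteqP; split => //; rewrite spanned0 => _ -> /=.
  by case: AL.
move: AB; rewrite spanned_recr; set e' := fun i => _; set v := e _ => AB.
have IHA : findim (A `&` spanned_by e').
  apply: (IH e'); last by move=> x [].
  have EL := spanned_subspace e'.
  by split; [case: AL; case: EL|move=> a x y [? ?] [? ?]; case: AL; case: EL; split; auto].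
have [sub|] := pselect (A `<=` spanned_by e').
  by move: IHA; rewrite setIidl.
move=> /existsNP[w] /not_implyP[Aw nw].
have /spanned_snoc[a [y [ey wE]]] := AB _ Aw.
have a0 : a != 0 by apply: contra_not_neq nw => a0; rewrite wE a0 scale0r addr0.
case: IHA => m [g gE]; exists m.+1, (snoc g w).
apply/seteqP; split => x.
  move=> Ax; apply/spanned_snoc; have /spanned_snoc[b [z [ez xE]]] := AB _ Ax.
  exists (b / a), (x - (b / a) *: w); rewrite subrK; split=> //.
  rewrite -gE; split; first by apply: subspaceB => //; exact: subspaceZ.
  rewrite xE wE scalerDr scalerA divfK // opprD addrACA subrr addr0.
  by have EL := spanned_subspace e'; apply: subspaceB => //; exact: subspaceZ.
move=> /spanned_snoc[b [z [+ ->]]]; rewrite -gE => -[Az _].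
by apply: subspaceD => //; exact: subspaceZ.
Qed.

Lemma findim_add A B : findim A -> findim B ->
  findim [set z | exists x y, [/\ A x, B y & z = x + y]].
Proof.
move=> [n [e eE]] [m [g gE]].
pose h (i : 'I_(n + m)) := match fintype.split i with inl i => e i | inr i => g i end.
have AL := findim_subspace (ex_intro _ n (ex_intro _ e eE)).
have BL := findim_subspace (ex_intro _ m (ex_intro _ g gE)).
exists (n + m)%N, h; apply/seteqP; split => z.
  case=> x [y []]; rewrite eE gE => -[c ->] [d ->] ->.
  exists (fun i => match fintype.split i with inl i => c i | inr i => d i end).
  rewrite big_split_ord /=; congr (_ + _); apply: eq_bigr => i _; rewrite /h.
    by rewrite (unsplitK (inl i)).
  by rewrite (unsplitK (inr i)).
case=> c ->; rewrite big_split_ord /=; do 2 eexists; split; last reflexivity.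
- apply: subspace_sum => // i; rewrite /h (unsplitK (inl i)) eE.
  exact: mem_spanned.
- apply: subspace_sum => // i; rewrite /h (unsplitK (inr i)) gE.
  exact: mem_spanned.
Qed.

Record fdsub := FdSub { fd_set : set V; fd_findim : findim fd_set }.

Lemma fdsub_eq (X Y : fdsub) : fd_set X = fd_set Y -> X = Y.
Proof. by case: X Y => X h [Y g] /= e; subst Y; congr FdSub; exact: Prop_irrelevance. Qed.

Definition fdsub_sort (X : fdsub) : Type := {x : V | x \in fd_set X}.

Section Carrier.
Variable X : fdsub.
HB.instance Definition _ := [isSub of fdsub_sort X for @proj1_sig V _].
HB.instance Definition _ := [Choice of fdsub_sort X by <:].
Lemma fdsub_closed : subsemimod_closed (fun x : V => x \in fd_set X).
Proof.
have XL := findim_subspace (fd_findim X).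
split; first split.
- by rewrite inE; case: XL.
- by move=> x y /set_mem Xx /set_mem Xy; apply/mem_set; exact: subspaceD.
- by move=> a x /set_mem Xx; apply/mem_set; exact: subspaceZ.
Qed.
HB.instance Definition _ := GRing.SubChoice_isSubLmodule.Build K V
  (fun x : V => x \in fd_set X) (fdsub_sort X) fdsub_closed.
End Carrier.

End FiniteDimensional.

Coercion fdsub_sort : fdsub >-> Sortclass.

Section BoundedOperators.
Variables (K : numFieldType) (V W : normedModType K).

Record bop := Bop {
  bop_lin :> {linear V -> W};
  bop_bounded : exists C : K, forall x, `|bop_lin x| <= C * `|x| }.
Implicit Types f g h : bop.

Lemma bop_eq f g : f =1 g -> f = g.
Proof.
case: f g => f hf [g hg] /= /linear_eq e; subst g; congr Bop.
exact: Prop_irrelevance.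
Qed.

HB.instance Definition _ := gen_eqMixin bop.
HB.instance Definition _ := gen_choiceMixin bop.

Lemma bop_add_bounded f g :
  exists C : K, forall x, `|lin_add f g x| <= C * `|x|.
Proof.
have [[C fC] [D gD]] := (bop_bounded f, bop_bounded g); exists (C + D) => x /=.
by rewrite mulrDl (le_trans (ler_normD _ _)) // lerD.
Qed.
Lemma bop_opp_bounded f : exists C : K, forall x, `|lin_opp f x| <= C * `|x|.
Proof. by have [C fC] := bop_bounded f; exists C => x /=; rewrite normrN. Qed.
Lemma bop_zero_bounded :
  exists C : K, forall x, `|lin_zero V W x| <= C * `|x|.
Proof. by exists 0 => x /=; rewrite normr0 mul0r. Qed.
Lemma bop_scale_bounded c f :
  exists C : K, forall x, `|lin_scale c f x| <= C * `|x|.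
Proof.
have [C fC] := bop_bounded f; exists (`|c| * C) => x /=.
by rewrite normrZ -mulrA ler_wpM2l.
Qed.

Definition bop_add f g := Bop (bop_add_bounded f g).
Definition bop_opp f := Bop (bop_opp_bounded f).
Definition bop_zero := Bop bop_zero_bounded.
Definition bop_scale c f := Bop (bop_scale_bounded c f).

Let addA : associative bop_add.
Proof. by move=> f g h; apply: bop_eq => x /=; rewrite addrA. Qed.
Let addC : commutative bop_add.
Proof. by move=> f g; apply: bop_eq => x /=; rewrite addrC. Qed.
Let add0 : left_id bop_zero bop_add.
Proof. by move=> f; apply: bop_eq => x /=; rewrite add0r. Qed.
Let addN : left_inverse bop_zero bop_opp bop_add.
Proof. by move=> f; apply: bop_eq => x /=; rewrite addNr. Qed.
HB.instance Definition _ := GRing.isZmodule.Build bop addA addC add0 addN.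

Let scaleA a b f : bop_scale a (bop_scale b f) = bop_scale (a * b) f.
Proof. by apply: bop_eq => x /=; rewrite scalerA. Qed.
Let scale1 : left_id 1 bop_scale.
Proof. by move=> f; apply: bop_eq => x /=; rewrite scale1r. Qed.
Let scaleDr : right_distributive bop_scale +%R.
Proof. by move=> a f g; apply: bop_eq => x /=; rewrite scalerDr. Qed.
Let scaleDl f : {morph bop_scale^~ f : a b / a + b}.
Proof. by move=> a b; apply: bop_eq => x /=; rewrite scalerDl. Qed.
HB.instance Definition _ := GRing.Zmodule_isLmodule.Build K bop
  scaleA scale1 scaleDr scaleDl.

End BoundedOperators.

Section OperatorNorm.
Variables (R : realType) (k : scalar_kind).
Local Notation K := (scalars R k).

(* The library norms take values in the scalar field; the operator norm is taken
   in R. *)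
Definition opnorm (V W : normedModType K) (T : bop V W) : R :=
  sup [set r | exists2 x, `|x| <= 1 & r = real_part `|T x|].

End OperatorNorm.

Section Operators.
Variables (K : numFieldType) (H : normedModType K).
Implicit Types S T : bop H H.

Lemma opmul_linear S T : linear (fun x => T (S x)).
Proof. by move=> a x y; rewrite !linearP. Qed.
Lemma opmul_bounded S T :
  exists C : K, forall x, `|mklin (opmul_linear S T) x| <= C * `|x|.
Proof.
have [[C SC] [D TD]] := (bop_bounded S, bop_bounded T).
have D0 : exists2 D' : K, 0 <= D' & forall x, `|T x| <= D' * `|x|.
  have [|/existsNP[x /eqP x0]] := pselect (forall x : H, x = 0).
    by move=> x0; exists 0 => // x; rewrite (x0 x) linear0 !normr0 mulr0.
  exists D => //; rewrite -(pmulr_lge0 _ (_ : 0 < `|x|)) ?normr_gt0 //.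
  exact: le_trans (TD x).
case: D0 => D' D'0 TD'; exists (D' * C) => x /=.
by rewrite (le_trans (TD' _)) // -mulrA ler_wpM2l.
Qed.
(* Left-to-right product: [opmul S T] is [S] followed by [T]. *)
Definition opmul S T := Bop (opmul_bounded S T).

Lemma opmulE S T x : opmul S T x = T (S x). Proof. by []. Qed.
Lemma opmulA S T U : opmul S (opmul T U) = opmul (opmul S T) U.
Proof. by apply: bop_eq => x. Qed.
Lemma opmulDr S T U : opmul S (T + U) = opmul S T + opmul S U.
Proof. by apply: bop_eq => x. Qed.
Lemma opmulDl S T U : opmul (T + U) S = opmul T S + opmul U S.
Proof. by apply: bop_eq => x /=; rewrite linearD. Qed.
Lemma opmulZr c S T : opmul S (c *: T) = c *: opmul S T.
Proof. by apply: bop_eq => x. Qed.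
Lemma opmulZl c S T : opmul (c *: S) T = c *: opmul S T.
Proof. by apply: bop_eq => x /=; rewrite linearZ. Qed.
Lemma opmul0r S : opmul S 0 = 0.
Proof. by apply: bop_eq => x. Qed.
Lemma opmul0l S : opmul 0 S = 0.
Proof. by apply: bop_eq => x /=; rewrite linear0. Qed.

Definition finite_rank : set (bop H H) := [set T | findim (range T)].

Lemma range_subspace (T : {linear H -> H}) : subspace (range T).
Proof.
split; first by exists 0; rewrite ?linear0.
by move=> a _ _ [x _ <-] [y _ <-]; exists (a *: x + y); rewrite ?linearP.
Qed.

Lemma finite_rank_sub T (A : set H) :
  findim A -> (forall x, A (T x)) -> finite_rank T.
Proof.
move=> hA TA; apply: findim_sub hA (range_subspace _) _.
by move=> _ [x _ <-].
Qed.

Lemma finite_rank_subspace : subspace finite_rank.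
Proof.
split.
  apply: (@finite_rank_sub _ [set 0]) => //.
  by exists 0%N, (fun=> 0); rewrite spanned0.
move=> a S T hS hT; apply: finite_rank_sub (findim_add hS hT) _ => x.
exists (a *: S x), (T x); split; last by [].
- by apply: (subspaceZ _ (range_subspace _)); exists x.
- by exists x.
Qed.

Lemma finite_rank_opmulr S T : finite_rank T -> finite_rank (opmul S T).
Proof. by move=> hT; apply: finite_rank_sub hT _ => x; exists (S x). Qed.

Lemma finite_rank_opmull S T : finite_rank S -> finite_rank (opmul S T).
Proof.
move=> [n [e eE]].
apply: (@finite_rank_sub _ (spanned_by (T \o e))); first by exists n, (T \o e).
move=> x; have : spanned_by e (S x) by rewrite -eE; exists x.
move=> [c cE]; exists c; rewrite /= cE linear_sum.
by apply: eq_bigr => i _; rewrite linearZ.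
Qed.

Definition principal (P : bop H H) : set (bop H H) :=
  [set opmul P A | A in finite_rank].

Definition corner (P Q : bop H H) : set (bop H H) :=
  [set opmul (opmul P A) Q | A in finite_rank].

End Operators.

Section HilbertTheory.
Variables (R : realType) (k : scalar_kind) (H : hilbertSpace R k).
Local Notation K := (scalars R k).
Local Notation "'[ x , y ]" := (inner H x y) : ring_scope.
Implicit Types (x y z u v m : H) (M N : fdsub H).

Lemma innerDl x y z : '[x + y, z] = '[x, z] + '[y, z].
Proof. exact: linearDl. Qed.
Lemma innerZl a x z : '[a *: x, z] = a * '[x, z].
Proof. by rewrite linearZl_LR. Qed.
Lemma inner_conj x y : '[x, y] = conj_scalar '[y, x].
Proof. by rewrite hermitian_subproof expr0 mul1r. Qed.
Lemma innerDr x y z : '[x, y + z] = '[x, y] + '[x, z].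
Proof. by rewrite inner_conj innerDl conj_scalarD -!inner_conj. Qed.
Lemma innerZr a x z : '[x, a *: z] = conj_scalar a * '[x, z].
Proof. by rewrite inner_conj innerZl conj_scalarM -inner_conj. Qed.
Lemma inner0l x : '[0, x] = 0.
Proof. by rewrite -(scale0r x) innerZl mul0r. Qed.
Lemma inner0r x : '[x, 0] = 0.
Proof. by rewrite inner_conj inner0l conj_scalar_ge0. Qed.
Lemma innerNl x z : '[- x, z] = - '[x, z].
Proof. by rewrite -scaleN1r innerZl mulN1r. Qed.
Lemma innerNr x z : '[x, - z] = - '[x, z].
Proof. by apply/eqP; rewrite -addr_eq0 -innerDr addNr inner0r. Qed.
Lemma innerBl x y z : '[x - y, z] = '[x, z] - '[y, z].
Proof. by rewrite innerDl innerNl. Qed.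
Lemma innerBr x y z : '[x, y - z] = '[x, y] - '[x, z].
Proof. by rewrite innerDr innerNr. Qed.
Lemma inner_eq0 x : '[x, x] = 0 -> x = 0.
Proof. by move=> /eqP; rewrite inner_norm expf_eq0 /= normr_eq0 => /eqP. Qed.

Lemma cauchy_schwarz x y : `|'[x, y]| <= `|y| * `|x|.
Proof.
have [->|y0] := eqVneq y 0; first by rewrite inner0r !normr0 mul0r.
have ny : 0 < `|y| by rewrite normr_gt0.
have n2 : `|y| ^+ 2 != 0 :> K by rewrite expf_neq0 // gt_eqF.
have cn : conj_scalar (`|y| ^+ 2) = `|y| ^+ 2 :> K by rewrite conj_scalar_ge0 // exprn_ge0.
rewrite -(@ler_sqr _ `|'[x, y]|) ?nnegrE ?mulr_ge0 // exprMn mulrC.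
set a := '[x, y].
have : 0 <= '[`|y| ^+ 2 *: x - a *: y, `|y| ^+ 2 *: x - a *: y].
  by rewrite inner_norm exprn_ge0.
rewrite innerBl !innerBr !innerZl !innerZr !inner_norm cn -/a.
rewrite (inner_conj y x) -/a.
have -> : `|y| ^+ 2 * (`|y| ^+ 2 * `|x| ^+ 2) - `|y| ^+ 2 * (conj_scalar a * a) -
   (a * (`|y| ^+ 2 * conj_scalar a) - a * (conj_scalar a * `|y| ^+ 2)) =
   `|y| ^+ 2 * (`|x| ^+ 2 * `|y| ^+ 2 - a * conj_scalar a) :> K.
  by ring.
by rewrite mul_conj_scalar pmulr_rge0 ?exprn_gt0 // subr_ge0.
Qed.

Lemma inner_linear m : linear (fun x => '[x, m] : K^o).
Proof. by move=> a x y; rewrite innerDl innerZl. Qed.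
Lemma inner_bounded m :
  exists C : K, forall x, `|mklin (inner_linear m) x| <= C * `|x|.
Proof. by exists `|m| => x; exact: cauchy_schwarz. Qed.

Definition riesz_functional m : bop H K^o := Bop (inner_bounded m).

Definition is_proj (M : set H) (P : bop H H) :=
  (forall x, M (P x)) /\ (forall x m, M m -> '[x - P x, m] = 0).

Lemma proj_uniq M P Q : is_proj (fd_set M) P -> is_proj (fd_set M) Q -> P = Q.
Proof.
move=> [PM PO] [QM QO]; apply: bop_eq => x; apply: subr0_eq; apply: inner_eq0.
have ML := findim_subspace (fd_findim M).
have D : fd_set M (P x - Q x) by exact: subspaceB.
rewrite -[X in '[X, _]](_ : (x - Q x) - (x - P x) = _); last first.
  by rewrite opprB addrC addrA subrK.
by rewrite innerBl PO // QO // subrr.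
Qed.

Lemma inner_ortho_spanned n (e : 'I_n -> H) x :
  (forall i, '[x, e i] = 0) -> forall m, spanned_by e m -> '[x, m] = 0.
Proof.
move=> xe m [c ->]; elim/big_rec: _ => [|i y _ IH]; first exact: inner0r.
by rewrite innerDr IH innerZr xe mulr0 addr0.
Qed.

Lemma dyad_linear u v : linear (fun x => '[x, u] *: v).
Proof. by move=> a x y; rewrite innerDl innerZl scalerDl scalerA. Qed.
Lemma dyad_bounded u v :
  exists C : K, forall x, `|mklin (dyad_linear u v) x| <= C * `|x|.
Proof.
exists (`|u| * `|v|) => x /=; rewrite normrZ mulrAC ler_wpM2r //.
exact: cauchy_schwarz.
Qed.
Definition dyad u v : bop H H := Bop (dyad_bounded u v).

Lemma spanned_proj n (e : 'I_n -> H) : exists P, is_proj (spanned_by e) P.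
Proof.
elim: n e => [|n IH] e.
  exists 0; rewrite spanned0; split=> //= x m ->; exact: inner0r.
rewrite spanned_recr; set e' := fun i : 'I_n => e (lift ord_max i); set v := e ord_max.
have [P [PM PO]] := IH e'; have EL := spanned_subspace e'.
have [u0|u0] := eqVneq (v - P v) 0.
  exists P; split => x.
    by apply/spanned_snoc; exists 0, (P x); split => //; rewrite scale0r addr0.
  move=> m /spanned_snoc[a [y [ey ->]]]; rewrite innerDr innerZr PO // add0r.
  by rewrite (subr0_eq u0) PO ?mulr0.
set u := v - P v in u0.
have Pu x : '[P x, u] = 0.
  by rewrite inner_conj PO // conj_scalar_ge0.
exists (P + dyad u (`|u| ^- 2 *: u)).
have E x : (P + dyad u (`|u| ^- 2 *: u)) x = P x + ('[x, u] / `|u| ^+ 2) *: u.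
  by rewrite /= scalerA.
split => x; rewrite !E.
  apply/spanned_snoc; set c := _ / _; exists c, (P x - c *: P v); split.
    by apply: subspaceB => //; exact: subspaceZ.
  by rewrite /u scalerBr addrA addrAC.
have Ou : '[x - (P x + ('[x, u] / `|u| ^+ 2) *: u), u] = 0.
  rewrite innerBl innerDl innerZl Pu add0r inner_norm divfK ?subrr //.
  by rewrite expf_neq0 // normr_eq0.
have Oe y : spanned_by e' y ->
   '[x - (P x + ('[x, u] / `|u| ^+ 2) *: u), y] = 0.
  by move=> ey; rewrite opprD addrA innerBl PO // innerZl PO // mulr0 subrr.
move=> m /spanned_snoc[a [y [ey ->]]].
rewrite innerDr innerZr Oe // add0r.
by rewrite -(subrK (P v) v) -/u innerDr Ou Oe // addr0 mulr0.
Qed.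

Lemma proj_exists M : exists P, is_proj (fd_set M) P.
Proof. by have [n [e ->]] := fd_findim M; exact: spanned_proj. Qed.

Definition proj M : bop H H := projT1 (cid (proj_exists M)).
Lemma projP M : is_proj (fd_set M) (proj M).
Proof. exact: projT2 (cid (proj_exists M)). Qed.
Lemma proj_mem M x : fd_set M (proj M x).
Proof. by case: (projP M). Qed.
Lemma proj_ortho M x m : fd_set M m -> '[x - proj M x, m] = 0.
Proof. by case: (projP M) => _; apply. Qed.
Lemma proj_id M m : fd_set M m -> proj M m = m.
Proof.
move=> Mm; apply/esym/subr0_eq/inner_eq0/proj_ortho.
by apply: subspaceB => //; [exact: findim_subspace (fd_findim M)|exact: proj_mem].
Qed.
Lemma proj_idem M : opmul (proj M) (proj M) = proj M.
Proof. by apply: bop_eq => x /=; rewrite proj_id //; exact: proj_mem. Qed.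
Lemma proj_finite_rank M : finite_rank (proj M).
Proof. by apply: finite_rank_sub (fd_findim M) _ => x; exact: proj_mem. Qed.

Lemma proj_eq0 M x : (forall m, fd_set M m -> '[x, m] = 0) -> proj M x = 0.
Proof.
move=> h; apply: inner_eq0; have Mp := proj_mem M x.
have := proj_ortho x Mp; rewrite innerBl h // sub0r => /eqP.
by rewrite oppr_eq0 => /eqP.
Qed.

Lemma proj_sub_inj M N : opmul (proj N) (proj M) = proj M -> fd_set M `<=` fd_set N.
Proof.
move=> e m Mm; have d0 : proj M (m - proj N m) = 0.
  by rewrite linearB /= -opmulE e subrr.
have -> : m = proj N m; last exact: proj_mem.
apply/subr0_eq/inner_eq0.
rewrite innerBr [X in _ - X]proj_ortho ?subr0; last exact: proj_mem.
by rewrite -[m - proj N m]subr0 -d0 proj_ortho.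
Qed.
End HilbertTheory.

Section Riesz.
Variables (R : realType) (k : scalar_kind) (H : hilbertSpace R k).
Local Notation K := (scalars R k).
Local Notation "'[ x , y ]" := (inner H x y) : ring_scope.
Implicit Types (x y z u v m : H) (M N : fdsub H).

Lemma ofR_gt0 (c : R) : (0 < ofR k c) = (0 < c).
Proof. by case: k => //=; rewrite ltcR. Qed.
Lemma real_part_gt0 (a : K) : 0 < a -> 0 < real_part a.
Proof. by move=> a0; rewrite -(ofR_gt0) real_partK // ltW. Qed.
Lemma ofRD (c d : R) : ofR k (c + d) = ofR k c + ofR k d.
Proof. by case: k => //=; rewrite rmorphD. Qed.
Lemma ofRM (c d : R) : ofR k (c * d) = ofR k c * ofR k d.
Proof. by case: k => //=; rewrite rmorphM. Qed.
Lemma ofRB (c d : R) : ofR k (c - d) = ofR k c - ofR k d.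
Proof. by case: k => //=; rewrite rmorphB. Qed.
Lemma ofR0 : ofR k (0 : R) = 0.
Proof. by case: k. Qed.
Lemma ofRn (n : nat) : ofR k (n%:R : R) = n%:R.
Proof. by case: k => //=; rewrite rmorph_nat. Qed.

Lemma parallelogram x y :
  `|x - y| ^+ 2 + `|x + y| ^+ 2 = 2 * `|x| ^+ 2 + 2 * `|y| ^+ 2 :> K.
Proof.
rewrite -!inner_norm !(innerBl, innerBr, innerDl, innerDr).
by move: '[x, x] '[x, y] '[y, x] '[y, y] => a b c d; ring.
Qed.

Lemma functional_lim (g : bop H K^o) (u_ : nat -> H) x (l : K) :
  u_ @ \oo --> x ->
  (forall c : R, 0 < c -> \forall n \near \oo, `|l - g (u_ n)| <= ofR k c) ->
  g x = l.
Proof.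
move=> ux gl.
have gc : {for x, continuous (g : H -> K^o)}.
  apply: bounded_linear_continuous; apply/linear_boundedP.
  have [C gC] := bop_bounded g.
  exists `|C|; split => // r Cr y; rewrite (le_trans (gC y)) //.
  have [->|y0] := eqVneq y 0; first by rewrite normr0 !mulr0.
  have ny : 0 < `|y| by rewrite normr_gt0.
  have C0 : 0 <= C by rewrite -(pmulr_lge0 C ny); exact: le_trans (gC y).
  by rewrite ler_wpM2r // -[C]ger0_norm // ltW.
have gux : (g \o u_) @ \oo --> (g x : K^o) by apply: continuous_cvg.
have gul : (g \o u_) @ \oo --> (l : K^o).
  apply/cvgrPdist_le => e e0; rewrite -(real_partK (ltW e0)).
  exact/gl/real_part_gt0.
exact: (cvg_unique (@norm_hausdorff _ _) gux gul).
Qed.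

Lemma completing_square (F : fieldType) (u a c q : F) : q != 0 ->
  u - c / q * a - (a / q * c - a / q * (c / q * q)) = u - (a * c) / q.
Proof. by move=> q0; field. Qed.

Lemma riesz (f : bop H K^o) : exists m, f = riesz_functional m.
Proof.
have [f0|/existsNP[z /eqP fz]] := pselect (forall x, f x = 0).
  by exists 0; apply: bop_eq => x; rewrite f0 /= inner0r.
have fz1 : f ((f z)^-1 *: z) = 1.
  by rewrite linearZ; exact: mulVf.
pose A := [set r : R | exists2 x, f x = 1 & r = real_part (`|x| ^+ 2)].
have Ainf : has_inf A.
  split; first by eexists; exists ((f z)^-1 *: z).
  exists 0 => _ [x _ ->]; rewrite -(ler_ofR k) real_partK ?exprn_ge0 //.
  by rewrite ofR0 exprn_ge0.
pose d := inf A.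
have dle x : f x = 1 -> ofR k d <= `|x| ^+ 2.
  move=> fx; rewrite -[X in _ <= X]real_partK ?exprn_ge0 // ler_ofR.
  by apply: ge_inf; [case: Ainf|exists x].
have ex n : exists x, f x = 1 /\ `|x| ^+ 2 <= ofR k (d + n.+1%:R^-1).
  have e0 : 0 < n.+1%:R^-1 :> R by rewrite invr_gt0.
  have [r [x fx ->] rlt] := inf_adherent e0 Ainf.
  exists x; split => //; rewrite -[X in X <= _]real_partK ?exprn_ge0 //.
  by rewrite ler_ofR ltW.
have [u_ uP] := choice ex.
pose e (n : nat) : R := n.+1%:R^-1.
have half (x y : H) : f x = 1 -> f y = 1 -> 4 * ofR k d <= `|x + y| ^+ 2.
  move=> fx fy; have h1 : f (2^-1 *: (x + y)) = 1.
    rewrite linearZ linearD fx fy.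
    by rewrite -[LHS]/(2^-1 * (1 + 1) : K) mulVf // pnatr_eq0.
  have := dle _ h1; rewrite normrZ exprMn normfV normr_nat exprVn.
  by rewrite ler_pdivlMl ?exprn_gt0 // expr2 -natrM.
have dist (n m : nat) : `|u_ n - u_ m| ^+ 2 <= ofR k (2 * (e n + e m)).
  have [[fn un] [fm' um]] := (uP n, uP m).
  rewrite -(lerD2r (`|u_ n + u_ m| ^+ 2)) parallelogram.
  have h := half _ _ fn fm'.
  apply: (le_trans (y := ofR k (2 * (e n + e m)) + 4 * ofR k d)); last first.
    by rewrite lerD2l.
  apply: (le_trans (y := 2 * ofR k (d + e n) + 2 * ofR k (d + e m))).
    by apply: lerD; apply: ler_wpM2l.
  rewrite -(ofRn 2) -(ofRn 4) -!ofRM -!ofRD ler_ofR.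
  by rewrite le_eqVlt; apply/orP; left; apply/eqP; ring.
have cu : cvg (u_ @ \oo).
  apply: cauchy_cvg; apply/cauchy_ballP => eps eps0.
  have r0 := real_part_gt0 eps0.
  have c0 : 0 < real_part eps ^+ 2 / 4 by rewrite divr_gt0 // exprn_gt0.
  have near_e : \forall n \near \oo, u_ n \in [set x | exists2 n, x = u_ n & e n < real_part eps ^+ 2 / 4].
    near=> n; rewrite inE; exists n => //.
    by near: n; exact: near_infty_natSinv_lt (PosNum c0).
  exists ([set x | exists2 n, x = u_ n & e n < real_part eps ^+ 2 / 4],
          [set x | exists2 n, x = u_ n & e n < real_part eps ^+ 2 / 4]).
    by split; apply: filterS near_e => n; rewrite inE.
  move=> [_ _] /= [[n -> en] [m -> em]].
  rewrite -ball_normE /ball_ /=.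
  rewrite -(@ltr_pXn2r K 2) ?nnegrE ?(ltW eps0) //.
  apply: le_lt_trans (dist n m) _.
  rewrite -[X in _ < X ^+ 2](real_partK (ltW eps0)) expr2 -ofRM -subr_gt0 -ofRB ofR_gt0.
  rewrite subr_gt0 -expr2; move: en em; set q := real_part eps ^+ 2; lra.
pose x := lim (u_ @ \oo).
have ux : u_ @ \oo --> x by exact: cu.
have fx : f x = 1.
  apply: functional_lim ux _ => c c0; near=> n.
  have [-> _] := uP n; rewrite subrr normr0 -ofR0 ler_ofR; exact: ltW.
have xO y : f y = 0 -> '[x, y] = 0.
  move=> fy; have [->|y0] := eqVneq y 0; first exact: inner0r.
  have ny : 0 < `|y| by rewrite normr_gt0.
  apply: (@functional_lim (riesz_functional y) u_) => // c c0.
  have r0 : 0 < real_part (`|y| ^+ 2) by apply/real_part_gt0; rewrite exprn_gt0.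
  have c1 : 0 < c ^+ 2 / real_part (`|y| ^+ 2) by rewrite divr_gt0 // exprn_gt0.
  near=> n.
  rewrite sub0r normrN /= -(@ler_sqr K) ?nnegrE //; last first.
    by rewrite ltW // ofR_gt0.
  have [fn un] := uP n.
  set a := '[_, _].
  have n2 : `|y| ^+ 2 != 0 :> K by rewrite expf_neq0 // gt_eqF.
  have ft : f (u_ n - (a / `|y| ^+ 2) *: y) = 1.
    rewrite linearB linearZ fy fn.
    by rewrite -[LHS]/(1 - (a / `|y| ^+ 2) * 0 : K) mulr0 subr0.
  have := dle _ ft; rewrite -inner_norm innerBl !innerBr !innerZl !innerZr.
  rewrite !inner_norm (inner_conj y) -/a.
  have -> : conj_scalar (a / `|y| ^+ 2) = conj_scalar a / `|y| ^+ 2 :> K.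
    by rewrite conj_scalarM (@conj_scalar_ge0 _ _ (_^-1)) // invr_ge0 exprn_ge0.
  have -> : `|u_ n| ^+ 2 - conj_scalar a / `|y| ^+ 2 * a -
    (a / `|y| ^+ 2 * conj_scalar a - a / `|y| ^+ 2 * (conj_scalar a / `|y| ^+ 2 * `|y| ^+ 2))
    = `|u_ n| ^+ 2 - (a * conj_scalar a) / `|y| ^+ 2 :> K.
    exact: completing_square.
  rewrite mul_conj_scalar => h.
  have : `|a| ^+ 2 / `|y| ^+ 2 <= ofR k (e n).
    rewrite -(lerD2l (ofR k d)) -ofRD; apply: le_trans un.
    by rewrite -lerBrDr.
  rewrite ler_pdivrMr ?exprn_gt0 //; move/le_trans; apply.
  have y2 := real_partK (exprn_ge0 2 (normr_ge0 y)).
  rewrite -y2 -ofRM [X in _ <= X]expr2 -ofRM ler_ofR -expr2.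
  rewrite -ler_pdivlMr //; apply: ltW; near: n.
  exact: near_infty_natSinv_lt (PosNum c1).
have x0 : `|x| ^+ 2 != 0 :> K.
  rewrite expf_neq0 // normr_eq0; apply: contra_eq_neq fx => ->.
  by rewrite linear0 eq_sym oner_neq0.
exists (`|x| ^- 2 *: x); apply: bop_eq => v.
have : '[v - f v *: x, x] = 0.
  rewrite inner_conj xO ?conj_scalar_ge0 // linearB linearZ fx.
  by rewrite -[LHS]/(f v - f v * 1 : K) mulr1 subrr.
rewrite innerBl innerZl inner_norm => /subr0_eq e1.
rewrite /= innerZr e1 conj_scalar_ge0 ?invr_ge0 ?exprn_ge0 //.
by rewrite mulrCA mulVf // mulr1.
Unshelve. all: by end_near. Qed.

Lemma principal_proj (P : bop H H) : finite_rank P -> opmul P P = P ->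
  exists M, principal P = principal (proj M).
Proof.
move=> [n [v vE]] PP.
have PxL x : P x = P (P x) by rewrite -[in LHS]PP.
have pb (w : H) : exists C : K, forall x,
    `|mklin (inner_linear w) (P x) : K^o| <= C * `|x|.
  have [C CP] := bop_bounded P.
  exists (`|w| * C) => x; rewrite (le_trans (cauchy_schwarz _ _)) //.
  by rewrite -mulrA ler_wpM2l.
have adj w : exists q, forall x, '[P x, w] = '[x, q].
  have fL : linear (fun x => '[P x, w] : K^o).
    by move=> a x y; rewrite linearP innerDl innerZl.
  have fB : exists C : K, forall x, `|mklin fL x| <= C * `|x| by exact: pb.
  have [q qE] := riesz (Bop fB); exists q => x.
  exact: (congr1 (fun g : bop H K^o => g x) qE).
have [q qP] := choice (fun i => adj (v i)).
have Mfd : findim (spanned_by q) by exists n, q.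
pose M := FdSub Mfd.
have kerP x : P x = 0 <-> proj M x = 0.
  split=> h.
    apply: proj_eq0; apply: inner_ortho_spanned => i.
    by rewrite -qP h inner0l.
  apply: inner_eq0; apply: (@inner_ortho_spanned _ _ _ _ v); last first.
    by rewrite -vE; exists x.
  move=> i; rewrite qP -[x]subr0 -h proj_ortho //; exact: mem_spanned.
have e1 : opmul (proj M) P = P.
  apply: bop_eq => x; apply/esym/subr0_eq; rewrite opmulE -linearB.
  by apply/kerP; rewrite linearB (@proj_id _ _ _ M (proj M x)) ?subrr //; exact: proj_mem.
have e2 : opmul P (proj M) = proj M.
  apply: bop_eq => x; apply/esym/subr0_eq; rewrite opmulE -linearB.
  by apply/kerP; rewrite linearB -PxL subrr.
have fM := proj_finite_rank M.
exists M; apply/seteqP; split => _ [B hB <-].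
  by exists (opmul P B); [exact: finite_rank_opmulr|rewrite opmulA e1].
by exists (opmul (proj M) B); [exact: finite_rank_opmulr|rewrite opmulA e2].
Qed.

Lemma principal_proj_inj M N :
  principal (proj M) = principal (proj N) -> M = N.
Proof.
have sub M' N' : principal (proj M') `<=` principal (proj N') ->
    fd_set M' `<=` fd_set N'.
  move=> s; apply: proj_sub_inj.
  have [|B _ BE] := s (proj M').
    by exists (proj M'); [exact: proj_finite_rank|exact: proj_idem].
  by rewrite -BE opmulA proj_idem.
by move=> e; apply: fdsub_eq; apply/seteqP; split; apply: sub; rewrite e.
Qed.

End Riesz.

(* Composition is in diagrammatic order: [mcomp f g] is [f] followed by [g]. *)
Record category := Category {
  obj : Type;
  mor : obj -> obj -> Type;
  mid : forall a, mor a a;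
  mcomp : forall a b c, mor a b -> mor b c -> mor a c;
  mcomp_idl : forall a b (f : mor a b), mcomp (mid a) f = f;
  mcomp_idr : forall a b (f : mor a b), mcomp f (mid b) = f;
  mcomp_assoc : forall a b c d (f : mor a b) (g : mor b c) (h : mor c d),
    mcomp f (mcomp g h) = mcomp (mcomp f g) h }.

(* Arrows packed with their endpoints, so that morphisms whose endpoints are only
   provably equal can be compared. *)
Record arrow (C : category) := Arrow {
  arrow_dom : obj C;
  arrow_cod : obj C;
  arrow_mor : mor arrow_dom arrow_cod }.

Record inclusion_category := InclusionCategory {
  base_category :> category;
  inclusion : forall a b : obj base_category, mor a b -> Prop }.

Section NormalCategories.
Variable C : inclusion_category.

Definition is_mono (a b : obj C) (f : mor a b) :=
  forall c (g h : mor c a), mcomp g f = mcomp h f -> g = h.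

Definition is_iso (a b : obj C) (f : mor a b) :=
  exists g : mor b a, mcomp f g = mid a /\ mcomp g f = mid b.

Record has_subobjects : Prop := HasSubobjects {
  inclusion_id : forall a : obj C, inclusion (mid a);
  inclusion_comp : forall (a b c : obj C) (f : mor a b) (g : mor b c),
    inclusion f -> inclusion g -> inclusion (mcomp f g);
  inclusion_uniq : forall (a b : obj C) (f g : mor a b),
    inclusion f -> inclusion g -> f = g;
  inclusion_anti : forall (a b : obj C) (f : mor a b) (g : mor b a),
    inclusion f -> inclusion g -> a = b;
  inclusion_mono : forall (a b : obj C) (f : mor a b),
    inclusion f -> is_mono f;
  inclusion_factor : forall (a b c : obj C)
      (f : mor a c) (h : mor a b) (g : mor b c),
    inclusion f -> inclusion g -> f = mcomp h g -> inclusion h }.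

Definition is_retraction (a b : obj C) (q : mor a b) :=
  exists j : mor b a, inclusion j /\ mcomp j q = mid b.

Definition has_normal_factorization (a b : obj C) (f : mor a b) :=
  exists (c d : obj C) (q : mor a c) (u : mor c d) (j : mor d b),
    [/\ is_retraction q, is_iso u, inclusion j & f = mcomp (mcomp q u) j].

Definition splits (a b : obj C) (j : mor a b) :=
  exists q : mor b a, mcomp j q = mid a.

Definition is_cone (d : obj C) (gamma : forall c, mor c d) :=
  forall (c c' : obj C) (j : mor c' c),
    inclusion j -> mcomp j (gamma c) = gamma c'.

Definition is_normal_cone (d : obj C) (gamma : forall c, mor c d) :=
  is_cone gamma /\ exists c, is_iso (gamma c).

Record is_normal_category : Prop := IsNormalCategory {
  normal_subobjects : has_subobjects;
  normal_factorizations : forall (a b : obj C) (f : mor a b),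
    has_normal_factorization f;
  normal_splittings : forall (a b : obj C) (j : mor a b),
    inclusion j -> splits j;
  normal_cones : forall d : obj C, exists gamma : forall c, mor c d,
    is_normal_cone gamma /\ gamma d = mid d }.

End NormalCategories.

Record functor (C D : category) := Functor {
  functor_obj :> obj C -> obj D;
  functor_mor : forall a b, mor a b -> mor (functor_obj a) (functor_obj b);
  functor_mor_id : forall a, functor_mor (mid a) = mid (functor_obj a);
  functor_mor_comp : forall a b c (f : mor a b) (g : mor b c),
    functor_mor (mcomp f g) = mcomp (functor_mor f) (functor_mor g) }.

Record inclusion_isomorphism (C D : inclusion_category) := InclusionIsomorphism {
  fwd :> functor C D;
  bwd : functor D C;
  fwd_inclusion : forall (a b : obj C) (f : mor a b),
    inclusion f -> inclusion (functor_mor fwd f);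
  bwd_inclusion : forall (a b : obj D) (f : mor a b),
    inclusion f -> inclusion (functor_mor bwd f);
  fwdK : forall (a b : obj C) (f : mor a b),
    Arrow (functor_mor bwd (functor_mor fwd f)) = Arrow f;
  bwdK : forall (a b : obj D) (f : mor a b),
    Arrow (functor_mor fwd (functor_mor bwd f)) = Arrow f }.

Section SubspaceCategory.
Variables (K : fieldType) (V : lmodType K).
Implicit Types X Y Z W : fdsub V.

Definition fdsub_id X : {linear X -> X} := idfun.
Definition fdsub_comp X Y Z (f : {linear X -> Y}) (g : {linear Y -> Z}) :
  {linear X -> Z} := g \o f.

Lemma fdsub_comp_idl X Y (f : {linear X -> Y}) : fdsub_comp (fdsub_id X) f = f.
Proof. exact: linear_eq. Qed.
Lemma fdsub_comp_idr X Y (f : {linear X -> Y}) : fdsub_comp f (fdsub_id Y) = f.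
Proof. exact: linear_eq. Qed.
Lemma fdsub_comp_assoc X Y Z W
    (f : {linear X -> Y}) (g : {linear Y -> Z}) (h : {linear Z -> W}) :
  fdsub_comp f (fdsub_comp g h) = fdsub_comp (fdsub_comp f g) h.
Proof. exact: linear_eq. Qed.

Definition subspace_category : inclusion_category :=
  @InclusionCategory (Category fdsub_comp_idl fdsub_comp_idr fdsub_comp_assoc)
    (fun X Y (f : {linear X -> Y}) => forall x : X, val (f x) = val x).

End SubspaceCategory.

Section RightIdeals.
Variables (R : realType) (k : scalar_kind) (H : hilbertSpace R k).
Local Notation K := (scalars R k).
Implicit Types (M N : fdsub H) (S T A : bop H H).

Record right_ideal := RightIdeal {
  ri_set : set (bop H H);
  ri_idem : exists P, [/\ finite_rank P, opmul P P = P & ri_set = principal P] }.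
Implicit Types X Y Z W : right_ideal.

Lemma right_ideal_eq X Y : ri_set X = ri_set Y -> X = Y.
Proof.
case: X Y => X h [Y g] /= e; subst Y; congr RightIdeal; exact: Prop_irrelevance.
Qed.

Lemma proj_ideal_idem M : exists P, [/\ finite_rank P, opmul P P = P &
  principal (proj M) = principal P].
Proof.
by exists (proj M); split=> //; [exact: proj_finite_rank|exact: proj_idem].
Qed.
Definition proj_ideal M : right_ideal := RightIdeal (proj_ideal_idem M).

Lemma proj_ideal_inj : injective proj_ideal.
Proof. by move=> M N [/principal_proj_inj]. Qed.

Lemma proj_ideal_surj X : exists M, X = proj_ideal M.
Proof.
have [P [fP PP XE]] := ri_idem X; have [M ME] := principal_proj fP PP.
by exists M; apply: right_ideal_eq; rewrite XE.
Qed.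

Lemma principal_subspace S : subspace (principal S).
Proof.
have [F0 FL] := finite_rank_subspace H; split; first by exists 0; rewrite ?opmul0r.
move=> a _ _ [A hA <-] [B hB <-]; exists (a *: A + B); first exact: FL.
by rewrite opmulDr opmulZr.
Qed.

Lemma ri_subspace X : subspace (ri_set X).
Proof. by have [P [_ _ ->]] := ri_idem X; exact: principal_subspace. Qed.

Lemma corner_subspace S T : subspace (corner S T).
Proof.
have [F0 FL] := finite_rank_subspace H; split.
  by exists 0; rewrite // opmul0r opmul0l.
move=> a _ _ [A hA <-] [B hB <-]; exists (a *: A + B); first exact: FL.
by rewrite opmulDr opmulZr opmulDl opmulZl.
Qed.

Lemma principal_opmulr S A B : principal S A -> finite_rank B ->
  principal S (opmul A B).
Proof.
move=> [A' fA' <-] fB; exists (opmul A' B); last by rewrite opmulA.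
exact: finite_rank_opmulr.
Qed.

(* [f] is the map A |-> TA with [T] in P_N S P_M, where X = P_M S, Y = P_N S. *)
Definition is_lambda X Y (f : ri_set X -> ri_set Y) T :=
  exists M N, [/\ X = proj_ideal M, Y = proj_ideal N, corner (proj N) (proj M) T &
    forall A : ri_set X, val (f A) = opmul T (val A)].

Record ri_hom X Y := RiHom {
  ri_fun :> ri_set X -> ri_set Y;
  ri_lambda : exists T, is_lambda ri_fun T }.

Lemma ri_hom_eq X Y (f g : ri_hom X Y) :
  (forall A : ri_set X, val (f A) = val (g A)) -> f = g.
Proof.
case: f g => f hf [g hg] /= e; have {}e : f = g 
  by apply/funext => A; apply: val_inj; exact: e.
by subst g; congr RiHom; exact: Prop_irrelevance.
Qed.

Definition to_set_type X A (XA : ri_set X A) : ri_set X := exist _ A (mem_set XA).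

Lemma lambda_mem M N T A : corner (proj N) (proj M) T -> finite_rank A ->
  principal (proj N) (opmul T A).
Proof.
move=> [B fB <-] fA; exists (opmul (opmul B (proj M)) A); last by rewrite !opmulA.
exact: finite_rank_opmulr.
Qed.

Lemma ri_finite_rank X A : ri_set X A -> finite_rank A.
Proof. by have [P [fP _ ->]] := ri_idem X => -[B fB <-]; exact: finite_rank_opmulr. Qed.

Section Lambda.
Variables (M N : fdsub H) (T : bop H H).
Hypothesis hT : corner (proj N) (proj M) T.

Definition lambda_fun (A : ri_set (proj_ideal M)) : ri_set (proj_ideal N) :=
  to_set_type (lambda_mem hT (ri_finite_rank (set_mem (valP A)))
               : ri_set (proj_ideal N) _).
Lemma lambda_subproof : exists T', is_lambda lambda_fun T'.
Proof. by exists T, M, N; split. Qed.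
Definition lambda : ri_hom (proj_ideal M) (proj_ideal N) := RiHom lambda_subproof.
End Lambda.

Lemma is_lambda_uniq X Y (f : ri_set X -> ri_set Y) T T' :
  is_lambda f T -> is_lambda f T' -> T = T'.
Proof.
move=> [M [N [XM YN [B fB TE] fE]]] [M' [N' [XM' YN' [B' fB' TE'] fE']]].
have eM : M = M' by apply: proj_ideal_inj; rewrite -XM.
have XP : ri_set X (proj M).
  by rewrite XM; exists (proj M); [exact: proj_finite_rank|exact: proj_idem].
have e : opmul T (proj M) = opmul T' (proj M).
  by have := fE (to_set_type XP); rewrite fE'.
by move: e; rewrite -TE -TE' -eM -!opmulA proj_idem.
Qed.

Definition ri_coef X Y (f : ri_hom X Y) : bop H H := projT1 (cid (ri_lambda f)).

Lemma ri_coefP X Y (f : ri_hom X Y) : is_lambda f (ri_coef f).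
Proof. exact: projT2 (cid (ri_lambda f)). Qed.

(* By [is_lambda_uniq] the operator [T] with [f] = lambda(P_M, T, P_N) is unique. *)
Definition ri_norm X Y (f : ri_hom X Y) : R := opnorm (ri_coef f).

Lemma lambda_coef M N T (hT : corner (proj N) (proj M) T) :
  ri_coef (lambda hT) = T.
Proof.
by apply: is_lambda_uniq (ri_coefP _) _; exists M, N; split.
Qed.

Lemma ri_norm_lambda M N T (hT : corner (proj N) (proj M) T) :
  ri_norm (lambda hT) = opnorm T.
Proof. by rewrite /ri_norm lambda_coef. Qed.

Lemma lambda_surj M N (f : ri_hom (proj_ideal M) (proj_ideal N)) :
  exists T (hT : corner (proj N) (proj M) T), f = lambda hT.
Proof.
have [T [M' [N' [/proj_ideal_inj eM /proj_ideal_inj eN + fE]]]] := ri_lambda f.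
rewrite -eM -eN => hT; exists T, hT; apply: ri_hom_eq => A; exact: fE.
Qed.

Lemma ri_id_subproof X : exists T, is_lambda (id : ri_set X -> ri_set X) T.
Proof.
have [M XM] := proj_ideal_surj X; subst X; exists (proj M), M, M; split => //.
  by exists (proj M); [exact: proj_finite_rank|rewrite !proj_idem].
move=> A; have [B _ BE] := set_mem (valP A).
suff e a : opmul (proj M) B = a -> a = opmul (proj M) a by exact: e BE.
by move=> <-; rewrite opmulA proj_idem.
Qed.
Definition ri_id X : ri_hom X X := RiHom (ri_id_subproof X).

Lemma ri_comp_subproof X Y Z (f : ri_hom X Y) (g : ri_hom Y Z) :
  exists T, is_lambda (g \o f) T.
Proof.
have [S [M [N [XM YN [A fA SE] fE]]]] := ri_lambda f.
have [T [N' [L [_ ZL [B fB TE] gE]]]] := ri_lambda g.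
exists (opmul T S), M, L; split => //; last first.
  by move=> C /=; rewrite gE fE opmulA.
exists (opmul (opmul (opmul B (proj N')) (proj N)) A).
  exact: finite_rank_opmulr.
by rewrite -TE -SE !opmulA.
Qed.
Definition ri_comp X Y Z (f : ri_hom X Y) (g : ri_hom Y Z) : ri_hom X Z :=
  RiHom (ri_comp_subproof f g).

Lemma ri_comp_idl X Y (f : ri_hom X Y) : ri_comp (ri_id X) f = f.
Proof. by apply: ri_hom_eq. Qed.
Lemma ri_comp_idr X Y (f : ri_hom X Y) : ri_comp f (ri_id Y) = f.
Proof. by apply: ri_hom_eq. Qed.
Lemma ri_comp_assoc X Y Z W (f : ri_hom X Y) (g : ri_hom Y Z) (h : ri_hom Z W) :
  ri_comp f (ri_comp g h) = ri_comp (ri_comp f g) h.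
Proof. by apply: ri_hom_eq. Qed.

Definition right_ideal_category : inclusion_category :=
  @InclusionCategory (Category ri_comp_idl ri_comp_idr ri_comp_assoc)
    (fun X Y (f : ri_hom X Y) => forall A : ri_set X, val (f A) = val A).

Section HomSpace.
Variables X Y : right_ideal.
Implicit Types f g : ri_hom X Y.

HB.instance Definition _ := gen_eqMixin (ri_hom X Y).
HB.instance Definition _ := gen_choiceMixin (ri_hom X Y).

Definition ri_comb_fun (a : K) f g (A : ri_set X) : ri_set Y :=
  to_set_type ((ri_subspace Y).2 a _ _ (set_mem (valP (f A))) (set_mem (valP (g A)))).

Lemma ri_comb_subproof a f g : exists T, is_lambda (ri_comb_fun a f g) T.
Proof.
have [S [M [N [XM YN SC fE]]]] := ri_lambda f.
have [T [M' [N' [XM' YN' TC gE]]]] := ri_lambda g.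
have eM : M' = M by apply: proj_ideal_inj; rewrite -XM.
have eN : N' = N by apply: proj_ideal_inj; rewrite -YN.
exists (a *: S + T), M, N; split => //.
  by apply: (corner_subspace _ _).2 => //; rewrite -eM -eN.
by move=> A /=; rewrite fE gE opmulDl opmulZl.
Qed.
Definition ri_comb a f g : ri_hom X Y := RiHom (ri_comb_subproof a f g).

Lemma ri_zero_subproof :
  exists T, is_lambda (fun _ : ri_set X => to_set_type (ri_subspace Y).1) T.
Proof.
have [[M XM] [N YN]] := (proj_ideal_surj X, proj_ideal_surj Y).
exists 0, M, N; split => //; first exact: (corner_subspace _ _).1.
by move=> A /=; rewrite opmul0l.
Qed.
Definition ri_zero : ri_hom X Y := RiHom ri_zero_subproof.

(* Pointwise operations; [lambdaD] and [lambdaZ] identify them with the operations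
   on the operators [T]. *)
Definition ri_add f g := ri_comb 1 f g.
Definition ri_scale a f := ri_comb a f ri_zero.
Definition ri_opp f := ri_scale (- 1) f.

Let addA : associative ri_add.
Proof. by move=> f g h; apply: ri_hom_eq => A /=; rewrite !scale1r addrA. Qed.
Let addC : commutative ri_add.
Proof. by move=> f g; apply: ri_hom_eq => A /=; rewrite !scale1r addrC. Qed.
Let add0 : left_id ri_zero ri_add.
Proof. by move=> f; apply: ri_hom_eq => A /=; rewrite scale1r add0r. Qed.
Let addN : left_inverse ri_zero ri_opp ri_add.
Proof.
by move=> f; apply: ri_hom_eq => A /=; rewrite scale1r addr0 scaleN1r addNr.
Qed.
HB.instance Definition _ := GRing.isZmodule.Build (ri_hom X Y) addA addC add0 addN.

Let scaleA a b f : ri_scale a (ri_scale b f) = ri_scale (a * b) f.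
Proof. by apply: ri_hom_eq => A /=; rewrite !addr0 scalerA. Qed.
Let scale1 : left_id 1 ri_scale.
Proof. by move=> f; apply: ri_hom_eq => A /=; rewrite addr0 scale1r. Qed.
Let scaleDr : right_distributive ri_scale +%R.
Proof.
by move=> a f g; apply: ri_hom_eq => A /=; rewrite !addr0 !scale1r scalerDr.
Qed.
Let scaleDl f : {morph ri_scale^~ f : a b / a + b}.
Proof.
by move=> a b; apply: ri_hom_eq => A /=; rewrite !addr0 !scale1r scalerDl.
Qed.
HB.instance Definition _ := GRing.Zmodule_isLmodule.Build K (ri_hom X Y)
  scaleA scale1 scaleDr scaleDl.

End HomSpace.

Lemma lambdaD M N T1 T2 (h1 : corner (proj N) (proj M) T1)
    (h2 : corner (proj N) (proj M) T2)
    (h : corner (proj N) (proj M) (T1 + T2)) :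
  lambda h1 + lambda h2 = lambda h.
Proof. by apply: ri_hom_eq => A /=; rewrite scale1r opmulDl. Qed.

Lemma lambdaZ M N a T (hT : corner (proj N) (proj M) T)
    (h : corner (proj N) (proj M) (a *: T)) :
  a *: lambda hT = lambda h.
Proof. by apply: ri_hom_eq => A /=; rewrite addr0 opmulZl. Qed.

Lemma lambda_comp M N L T1 T2 (h1 : corner (proj N) (proj M) T1)
    (h2 : corner (proj L) (proj N) T2)
    (h : corner (proj L) (proj M) (opmul T2 T1)) :
  ri_comp (lambda h1) (lambda h2) = lambda h.
Proof. by apply: ri_hom_eq => A /=; rewrite opmulA. Qed.

End RightIdeals.

Section Dual.
Variables (R : realType) (k : scalar_kind) (H : hilbertSpace R k).
Local Notation K := (scalars R k).

Definition dual_space : lmodType K := bop H K^o.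

Lemma riesz_functional_sum n (c : 'I_n -> K) (e : 'I_n -> H) :
  riesz_functional (\sum_i c i *: e i) = 
    \sum_i conj_scalar (c i) *: riesz_functional (e i) :> dual_space.
Proof.
apply: bop_eq => x; elim/big_rec2: _ => [|i f y _ IH].
  by rewrite /= inner0r.
by rewrite [LHS]/= innerDr innerZr /=; congr (_ + _).
Qed.

Lemma dual_subspace_findim (M : fdsub H) :
  findim ([set riesz_functional m | m in fd_set M] : set dual_space).
Proof.
have [n [e eE]] := fd_findim M; exists n, (fun i => riesz_functional (e i)).
apply/seteqP; split => [_ [m + <-]|f [c ->]]; rewrite eE.
  by move=> [c ->]; exists (fun i => conj_scalar (c i)); rewrite riesz_functional_sum.
exists (\sum_i conj_scalar (c i) *: e i); first by exists (fun i => conj_scalar (c i)).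
by rewrite riesz_functional_sum; apply: eq_bigr => i _; rewrite conj_scalarK.
Qed.

Definition dual_subspace (M : fdsub H) : fdsub dual_space :=
  FdSub (dual_subspace_findim M).

Definition subspace_hom_norm (X Y : fdsub dual_space) (f : {linear X -> Y}) : R :=
  sup [set r | exists2 x : X, opnorm (val x : bop H K^o) <= 1
                            & r = opnorm (val (f x) : bop H K^o)].

End Dual.

(* Main.v *)
(* The isomorphism sends lambda(P_M, T, P_N) to the transpose g |-> g o T, which maps
   M' = {g : g o P_M = g} into N'.  It is bijective on objects by the Riesz theorem and
   on hom-sets because P_M is a finite sum of operators x |-> <x, u_i> v_i, so that T can
   be recovered from the images of the functionals f_{P_M u_i}.  Inclusions correspond on
   both sides to T = P_M.  A functor with these properties reflects normality, which for
   the subspaces of H' follows from the linear projections g |-> g o P_M of H' onto M'. *)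
Require Import Defs.
From mathcomp Require Import all_boot all_order all_algebra.
From mathcomp Require Import all_classical all_reals all_analysis.
Set Implicit Arguments.
Unset Strict Implicit.
Unset Printing Implicit Defensive.
Import Order.TTheory GRing.Theory Num.Theory.
Local Open Scope ring_scope.

(** * Equality of morphisms packed with their endpoints *)

Section ArrowEquality.
Variable C : category.

(** The endpoints of the packed arrows are the same on both sides, so the morphism is recovered by
    transport along loops, and proof irrelevance turns those loops into [erefl]. *)
Lemma Arrow_inj (a b : obj C) : injective (@Arrow C a b).
Proof.
move=> f g e.
pose transport (h : arrow C) (ea : arrow_dom h = a) (eb : arrow_cod h = b) :=
  ecast x (mor x b) ea (ecast y (mor (arrow_dom h) y) eb (arrow_mor h)).
(* With [h] and the endpoint proofs general, the equation can be substituted before the casts are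
   simplified. *)
suff tE h (eh : Arrow f = h) ea eb : transport h ea eb = f by rewrite -(tE _ e erefl erefl).
by subst h; rewrite (Prop_irrelevance ea erefl) (Prop_irrelevance eb erefl).
Qed.

Lemma Arrow_mcomp (a b c a' b' c' : obj C) (f : mor a b) (g : mor b c)
    (f' : mor a' b') (g' : mor b' c') :
  Arrow f = Arrow f' -> Arrow g = Arrow g' ->
  Arrow (mcomp f g) = Arrow (mcomp f' g').
Proof.
move=> ef eg; move: (congr1 (@arrow_dom C) ef) (congr1 (@arrow_cod C) ef)
  (congr1 (@arrow_cod C) eg) => /= ea eb ec; subst a' b' c'.
by rewrite (Arrow_inj ef) (Arrow_inj eg).
Qed.

Lemma Arrow_mid (a a' : obj C) : a = a' -> Arrow (mid a) = Arrow (mid a').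
Proof. by move=> ->. Qed.

End ArrowEquality.

Lemma Arrow_inclusion (C : inclusion_category) (a b a' b' : obj C)
    (f : mor a b) (f' : mor a' b') :
  Arrow f = Arrow f' -> inclusion f -> inclusion f'.
Proof.
move=> ef; move: (congr1 (@arrow_dom C) ef) (congr1 (@arrow_cod C) ef) => /= ea eb.
by subst a' b'; rewrite (Arrow_inj ef).
Qed.

(** * Isomorphisms of categories with inclusions, expressed as properties of a single functor *)

Record strict_equivalence (C D : inclusion_category) (F : functor C D) : Prop :=
  StrictEquivalence {
    strict_inj : injective F;
    strict_surj : forall d, exists c, F c = d;
    strict_faithful : forall a b, injective (@functor_mor _ _ F a b);
    strict_full : forall a b (g : mor (F a) (F b)), exists f, functor_mor F f = g;
    strict_inclusion : forall (a b : obj C) (f : mor a b),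
      inclusion f <-> inclusion (functor_mor F f) }.

Section StrictEquivalence.
Variables (C D : inclusion_category) (F : functor C D).
Hypothesis FE : strict_equivalence F.

Lemma reflect_iso (a b : obj C) (f : mor a b) :
  is_iso (functor_mor F f) -> is_iso f.
Proof.
case=> g [fg gf]; have [g' gE] := strict_full FE g; exists g'.
by split; apply: (strict_faithful FE); rewrite functor_mor_comp functor_mor_id gE.
Qed.

Lemma reflect_retraction (a b : obj C) (f : mor a b) :
  is_retraction (functor_mor F f) -> is_retraction f.
Proof.
case=> j [ji jf]; have [j' jE] := strict_full FE j; subst j; exists j'.
split; first exact/(strict_inclusion FE).
by apply: (strict_faithful FE); rewrite functor_mor_comp functor_mor_id.
Qed.

Lemma reflect_has_subobjects : has_subobjects D -> has_subobjects C.
Proof.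
move=> DS; split.
- by move=> a; apply/(strict_inclusion FE); rewrite functor_mor_id; exact: inclusion_id.
- move=> a b c f g /(strict_inclusion FE) fi /(strict_inclusion FE) gi.
  by apply/(strict_inclusion FE); rewrite functor_mor_comp; exact: inclusion_comp.
- move=> a b f g /(strict_inclusion FE) fi /(strict_inclusion FE) gi.
  exact/(strict_faithful FE)/(inclusion_uniq DS).
- move=> a b f g /(strict_inclusion FE) fi /(strict_inclusion FE) gi.
  exact/(strict_inj FE)/(inclusion_anti DS fi gi).
- move=> a b f /(strict_inclusion FE) fi c g h e; apply: (strict_faithful FE).
  by apply: (inclusion_mono DS fi); rewrite -!functor_mor_comp e.
- move=> a b c f h g /(strict_inclusion FE) fi /(strict_inclusion FE) gi e.
  apply/(strict_inclusion FE)/(inclusion_factor DS fi gi).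
  by rewrite e functor_mor_comp.
Qed.

(** All data found in [D] lift along fullness and surjectivity on objects; the equations between the
    lifts are checked in [D] by faithfulness. *)
Lemma reflect_normal_category : is_normal_category D -> is_normal_category C.
Proof.
case=> DS DF DI DC; split; first exact: reflect_has_subobjects.
- move=> a b f; have [c [d [q [u [j]]]]] := DF _ _ (functor_mor F f).
  have [c' cE] := strict_surj FE c; have [d' dE] := strict_surj FE d; subst c d.
  have [q' qE] := strict_full FE q; have [u' uE] := strict_full FE u.
  have [j' jE] := strict_full FE j; subst q u j.
  move=> [/reflect_retraction qr /reflect_iso ui /(strict_inclusion FE) ji fE].
  exists c', d', q', u', j'; split => //.
  by apply: (strict_faithful FE); rewrite !functor_mor_comp.
- move=> a b j /(strict_inclusion FE) /DI[q jq].
  have [q' qE] := strict_full FE q; subst q; exists q'.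
  by apply: (strict_faithful FE); rewrite functor_mor_comp functor_mor_id.
- move=> d; have [gamma [[gcone [c0 giso]] gd]] := DC (F d).
  (* The components of the cone are lifted one by one by choice; faithfulness then makes them
     compatible with inclusions. *)
  have [delta deltaE] : {delta : forall c, mor c d |
      forall c, functor_mor F (delta c) = gamma (F c)}.
    exists (fun c => projT1 (cid (strict_full FE (gamma (F c))))) => c.
    exact: projT2 (cid (strict_full FE (gamma (F c)))).
  exists delta; split; last first.
    by apply: (strict_faithful FE); rewrite deltaE functor_mor_id.
  split.
    move=> c c' j /(strict_inclusion FE) ji; apply: (strict_faithful FE).
    by rewrite functor_mor_comp !deltaE; exact: gcone.
  have [c cE] := strict_surj FE c0; subst c0; exists c.
  by apply: reflect_iso; rewrite deltaE.
Qed.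

Definition preimage_obj (d : obj D) : obj C := projT1 (cid (strict_surj FE d)).

Lemma preimage_objK d : F (preimage_obj d) = d.
Proof. exact: projT2 (cid (strict_surj FE d)). Qed.

(** The equation [F (preimage_obj d) = d] is only propositional, so the lift is compared with [g] as
    a packed arrow. Once the chosen preimages are generalised, [d] and [d'] can be substituted and
    fullness applies. *)
Lemma preimage_mor_exists (d d' : obj D) (g : mor d d') :
  exists f : mor (preimage_obj d) (preimage_obj d'),
    Arrow (functor_mor F f) = Arrow g.
Proof.
move: (preimage_objK d) (preimage_objK d').
move: (preimage_obj d) (preimage_obj d') => c c' e e'; subst d d'.
by have [f <-] := strict_full FE g; exists f.
Qed.

Definition preimage_mor (d d' : obj D) (g : mor d d') :
  mor (preimage_obj d) (preimage_obj d') := projT1 (cid (preimage_mor_exists g)).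

Lemma preimage_morK (d d' : obj D) (g : mor d d') :
  Arrow (functor_mor F (preimage_mor g)) = Arrow g.
Proof. exact: projT2 (cid (preimage_mor_exists g)). Qed.

Lemma preimage_mor_id (d : obj D) : preimage_mor (mid d) = mid (preimage_obj d).
Proof.
apply: (strict_faithful FE); apply: Arrow_inj; rewrite preimage_morK functor_mor_id.
by apply: Arrow_mid; rewrite preimage_objK.
Qed.

Lemma preimage_mor_comp (a b c : obj D) (f : mor a b) (g : mor b c) :
  preimage_mor (mcomp f g) = mcomp (preimage_mor f) (preimage_mor g).
Proof.
apply: (strict_faithful FE); apply: Arrow_inj; rewrite preimage_morK functor_mor_comp.
by apply: Arrow_mcomp; rewrite preimage_morK.
Qed.

Definition preimage_functor : functor D C := Functor preimage_mor_id preimage_mor_comp.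

Lemma preimage_functor_inclusion (a b : obj D) (f : mor a b) :
  inclusion f -> inclusion (functor_mor preimage_functor f).
Proof.
move=> fi; apply/(strict_inclusion FE); apply: Arrow_inclusion fi.
by rewrite -[LHS]preimage_morK.
Qed.

(** Injectivity on objects identifies the chosen preimage of [F a] with [a]; after that substitution
    faithfulness concludes. *)
Lemma functor_morK (a b : obj C) (f : mor a b) :
  Arrow (functor_mor preimage_functor (functor_mor F f)) = Arrow f.
Proof.
have := preimage_morK (functor_mor F f); rewrite /=.
move: (preimage_mor _); rewrite -/(preimage_obj _).
have := strict_inj FE (preimage_objK (F a)); have := strict_inj FE (preimage_objK (F b)).
move: (preimage_obj (F a)) (preimage_obj (F b)) => c c' e e' h; subst c c'.
by move=> /Arrow_inj /(strict_faithful FE) ->.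
Qed.

Definition strict_equivalence_isomorphism : inclusion_isomorphism C D :=
  InclusionIsomorphism (fun a b f => (strict_inclusion FE f).1)
    preimage_functor_inclusion functor_morK preimage_morK.

End StrictEquivalence.

(** * Normality of the category of finite-dimensional subspaces *)

Section SubspaceCategoryTheory.
Variables (K : fieldType) (V : lmodType K).
Implicit Types X Y Z : fdsub V.

Lemma mem_fdsub X (x : X) : fd_set X (val x).
Proof. exact/set_mem/(valP x). Qed.

Definition to_fdsub X v (Xv : fd_set X v) : X := exist _ v (mem_set Xv).

(** Serves to compare maps between subspaces that are equal only provably: the test takes place on
    the underlying vectors of [V]. *)
Lemma subspace_Arrow_eq X Y X' Y' (f : {linear X -> Y}) (f' : {linear X' -> Y'}) :
  X = X' -> Y = Y' ->
  (forall x x', val x = val x' -> val (f x) = val (f' x')) ->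
  @Arrow (subspace_category V) X Y f = @Arrow (subspace_category V) X' Y' f'.
Proof.
move=> eX eY; subst X' Y' => h; congr (@Arrow (subspace_category V) _ _ _).
by apply: linear_eq => x; apply: val_inj; exact: h.
Qed.

Section Restriction.
Variables (X Y : fdsub V) (p : {linear V -> V}).
Hypothesis pXY : forall x, fd_set X x -> fd_set Y (p x).

Definition fdsub_restrict_fun (x : X) : Y := to_fdsub (pXY (mem_fdsub x)).

Lemma fdsub_restrict_linear : linear fdsub_restrict_fun.
Proof. by move=> a x y; apply: val_inj; rewrite /= linearP. Qed.

Definition fdsub_restrict : {linear X -> Y} := mklin fdsub_restrict_linear.

End Restriction.

Definition fdsub_incl X Y (XY : (fd_set X `<=` fd_set Y)%classic) : {linear X -> Y} :=
  @fdsub_restrict X Y idfun XY.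

Lemma inclusion_sub X Y (f : {linear X -> Y}) :
  @inclusion (subspace_category V) X Y f -> (fd_set X `<=` fd_set Y)%classic.
Proof.
move=> fi x Xx; rewrite -[x]/(val (to_fdsub Xx)) -fi; exact: mem_fdsub.
Qed.

Lemma subspace_has_subobjects : has_subobjects (subspace_category V).
Proof.
split=> //=.
- by move=> X Y Z f g fi gi x; exact: etrans (gi (f x)) (fi x).
- move=> X Y f g fi gi; apply: linear_eq => x; apply: val_inj.
  exact: etrans (fi x) (esym (gi x)).
- move=> X Y f g fi gi; apply: fdsub_eq; apply/seteqP.
  by split; [exact: inclusion_sub fi|exact: inclusion_sub gi].
- move=> X Y f fi Z g h e; apply: linear_eq => z; apply: val_inj.
  apply: etrans (esym (fi (g z))) (etrans _ (fi (h z))).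
  exact: (congr1 (fun u : {linear Z -> Y} => val (u z)) e).
- move=> X Y Z f h g fi gi e x; apply: etrans (esym (gi (h x))) _.
  by rewrite -fi e.
Qed.

Lemma bijective_is_iso X Y (f : {linear X -> Y}) :
  bijective f -> @is_iso (subspace_category V) X Y f.
Proof.
case=> g fK gK; have gL : linear g by exact: can2_linear fK gK.
by exists (mklin gL); split; apply: linear_eq => x /=; [exact: fK|exact: gK].
Qed.

(** Isolates what normality needs from the ambient space, so that the argument stays purely
    algebraic; for the dual space the maps are the transposes of the [proj M]. *)
Definition has_projections :=
  forall X, exists p : {linear V -> V},
    (forall v, fd_set X (p v)) /\ (forall v, fd_set X v -> p v = v).

Hypothesis proj : has_projections.

(** Let [p] project [V] onto the kernel of [f]. Then [X] is the direct sum of that kernel and [W],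
    the vectors of [X] killed by [p]. The factors are the map [1 - p] from [X] onto [W], the
    isomorphism of [W] with the image [J] of [f], and the inclusion of [J] in [Y]. *)
Lemma subspace_normal_factorization X Y (f : {linear X -> Y}) :
  @has_normal_factorization (subspace_category V) X Y f.
Proof.
have Xsub := findim_subspace (fd_findim X).
pose Zs : set V := ([set v | exists2 x : X, f x = 0 & v = val x])%classic.
have Zfd : findim Zs.
  apply: findim_sub (fd_findim X) _ _.
    split; first by exists 0; rewrite ?linear0.
    move=> a _ _ [x fx ->] [y fy ->]; exists (a *: x + y) => //.
    by rewrite linearP fx fy scaler0 addr0.
  by move=> _ [x _ ->]; exact: mem_fdsub.
have [p [pZ pid]] := proj (FdSub Zfd).
have ZX v : Zs v -> fd_set X v by case=> x _ ->; exact: mem_fdsub.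
pose Cs : set V := ([set v | fd_set X v /\ p v = 0])%classic.
have Cfd : findim Cs.
  apply: findim_sub (fd_findim X) _ _; last by move=> v [].
  split; first by split; [case: Xsub|rewrite linear0].
  move=> a x y [Xx px] [Xy py]; split; first by case: Xsub => _; exact.
  by rewrite linearP px py scaler0 addr0.
pose W := FdSub Cfd.
have WX : (fd_set W `<=` fd_set X)%classic by move=> v [].
pose i := fdsub_incl WX.
pose Is : set V := ([set v | exists x : X, v = val (f x)])%classic.
have Ifd : findim Is.
  apply: findim_sub (fd_findim Y) _ _; last by move=> _ [x ->]; exact: mem_fdsub.
  split; first by exists 0; rewrite linear0.
  by move=> a _ _ [x ->] [y ->]; exists (a *: x + y); rewrite linearP.
pose J := FdSub Ifd.
have JY : (fd_set J `<=` fd_set Y)%classic by move=> _ [x ->]; exact: mem_fdsub.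
have qL : linear (fun v => v - p v).
  by move=> a x y; rewrite linearP scalerBr opprD addrACA.
have qXW x : fd_set X x -> fd_set W (mklin qL x).
  move=> Xx /=; split; first by apply: subspaceB => //; exact/ZX/pZ.
  by rewrite linearB /= (pid (p x)) ?subrr //; exact: pZ.
pose q : {linear X -> W} := fdsub_restrict qXW.
have uP (w : W) : fd_set J (val (f (i w))) by exists (i w).
have uL : linear (fun w => to_fdsub (uP w)).
  by move=> a x y; apply: val_inj; rewrite -[LHS]/(val (f (i (a *: x + y)))) !linearP.
pose u : {linear W -> J} := mklin uL.
(* The vectors [x] and [q x] differ by [p x], which lies in the kernel of [f]. *)
have fq x : f (i (q x)) = f x.
  have [z fz zE] := pZ (val x).
  have -> : i (q x) = x - z by apply: val_inj; rewrite /= zE.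
  by rewrite linearB fz subr0.
have qi w : q (i w) = w.
  by apply: val_inj => /=; have [_ ->] := mem_fdsub w; rewrite subr0.
exists W, J, q, u, (fdsub_incl JY : {linear J -> Y}); split => //.
- by exists i; split => //; apply: linear_eq => w; exact: qi.
- apply: bijective_is_iso.
  have inv (y : J) : exists w, u w = y.
    by have [x xE] := mem_fdsub y; exists (q x); apply: val_inj; rewrite /= fq xE.
  have [g gK] := choice inv; exists g => // w.
  (* A vector of [W] in the kernel of [f] is both fixed and killed by [p]. *)
  have fi0 w' : u w' = 0 -> w' = 0.
    move=> /(congr1 val) /= e; apply: val_inj => /=.
    have [_ pw] := mem_fdsub w'; rewrite -pw; apply/esym/pid.
    by exists (i w') => //; apply: val_inj.
  by apply/subr0_eq/fi0; rewrite linearB gK subrr.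
- by apply: linear_eq => x; apply: val_inj; rewrite /= fq.
Qed.

(** One projection [p] of all of [V] onto [X] serves twice: its restriction to [Y] splits an
    inclusion of [X] in [Y], and its restrictions to all subspaces form a cone whose component at
    [X] is the identity. *)
Lemma subspace_normal_category : is_normal_category (subspace_category V).
Proof.
split; first exact: subspace_has_subobjects.
- exact: subspace_normal_factorization.
- move=> X Y j ji; have [p [pX pid]] := proj X.
  have pYX v : fd_set Y v -> fd_set X (p v) by [].
  exists (fdsub_restrict pYX); apply: linear_eq => x; apply: val_inj => /=.
  by rewrite ji pid //; exact: mem_fdsub.
- move=> X; have [p [pX pid]] := proj X.
  have pYX Y v : fd_set Y v -> fd_set X (p v) by [].
  pose gamma Y : @mor (subspace_category V) Y X := fdsub_restrict (@pYX Y).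
  have gX : gamma X = mid (X : obj (subspace_category V)).
    by apply: linear_eq => x; apply: val_inj; rewrite /= pid //; exact: mem_fdsub.
  exists gamma; split => //; split.
    move=> Y Y' j ji; apply: linear_eq => y; apply: val_inj => /=.
    by rewrite ji.
  by exists X, (mid (X : obj (subspace_category V))); rewrite gX mcomp_idl.
Qed.

End SubspaceCategoryTheory.

(** * The real-valued operator norm *)

Section OperatorNormTheory.
Variables (R : realType) (k : scalar_kind).
Local Notation K := (scalars R k).

Lemma real_part_le (a b : K) : 0 <= a -> 0 <= b -> a <= b -> real_part a <= real_part b.
Proof. by move=> a0 b0 ab; rewrite -(ler_ofR k) !real_partK. Qed.

Lemma real_part_ge0 (a : K) : 0 <= a -> 0 <= real_part a.
Proof. by move=> a0; rewrite -(ler_ofR k) ofR0 real_partK. Qed.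

Lemma real_part_nat (n : nat) : real_part (n%:R : K) = n%:R.
Proof. by rewrite -(ofRn R k n) ofRK. Qed.

Lemma real_partM (a b : K) : 0 <= a -> 0 <= b ->
  real_part (a * b) = real_part a * real_part b.
Proof.
by move=> a0 b0; rewrite -{1}(real_partK a0) -{1}(real_partK b0) -ofRM ofRK.
Qed.

Variables (V W : normedModType K).
Implicit Types T : bop V W.

Lemma opnorm_ub T x : `|x| <= 1 -> real_part `|T x| <= opnorm T.
Proof.
move=> x1; apply: ub_le_sup; last by exists x.
(* Only a nonzero vector forces [C] to be nonnegative, hence the absolute value and the separate
   case [y = 0]. *)
have [C TC] := bop_bounded T; exists (real_part `|C|) => _ [y y1 ->].
apply: real_part_le => //; have [->|y0] := eqVneq y 0.
  by rewrite linear0 normr0.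
have C0 : 0 <= C.
  rewrite -(pmulr_lge0 _ (_ : 0 < `|y|)) ?normr_gt0 //; exact: le_trans (TC y).
by rewrite (le_trans (TC y)) // ger0_norm // ler_piMr.
Qed.

Lemma opnorm_le T c :
  (forall x, `|x| <= 1 -> real_part `|T x| <= c) -> opnorm T <= c.
Proof.
move=> Tc; apply: sup_le_ub; first by exists (real_part `|T 0|), 0; rewrite ?normr0.
by move=> _ [x x1 ->]; exact: Tc.
Qed.

Lemma opnorm_ge0 T : 0 <= opnorm T.
Proof.
by apply: le_trans (opnorm_ub T (_ : `|0| <= 1)); rewrite ?normr0 // real_part_ge0.
Qed.

Lemma opnorm_apply T x : real_part `|T x| <= opnorm T * real_part `|x|.
Proof.
have [->|x0] := eqVneq x 0.
  by rewrite linear0 !normr0 -[0 : K]/(0%:R) real_part_nat mulr0.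
have nx : `|x| != 0 by rewrite normr_eq0.
(* Writes [x] as its norm times a unit vector. *)
rewrite -[in `|T x|](scale1r x) -(divff nx) -scalerA linearZ normrZ normr_id.
rewrite real_partM // mulrC ler_wpM2r ?real_part_ge0 //.
by apply: opnorm_ub; rewrite normrZ normfV normr_id mulVf.
Qed.

End OperatorNormTheory.

(** * Transposes as linear maps between the subspaces of the dual *)

Section DualMaps.
Variables (R : realType) (k : scalar_kind) (H : hilbertSpace R k).
Local Notation K := (scalars R k).
Local Notation proj := Defs.proj.
Local Notation "'[ x , y ]" := (inner H x y) : ring_scope.
Implicit Types (x y m : H) (M N : fdsub H) (T S : bop H H) (g : bop H K^o).

(** Both sides equal the inner product of [proj M x] and [proj M y], since the residuals are
    orthogonal to [M]. *)
Lemma proj_inner M x y : '[proj M x, y] = '[x, proj M y].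
Proof.
transitivity '[proj M x, proj M y].
  apply/eqP; rewrite -subr_eq0 -innerBr inner_conj Defs.proj_ortho ?conj_scalar_ge0 //.
  exact: proj_mem.
apply/eqP; rewrite eq_sym -subr_eq0 -innerBl Defs.proj_ortho //; exact: proj_mem.
Qed.

(** The difference [x - y] lies in [M], so it is orthogonal to itself. *)
Lemma fdsub_inner_inj M x y : fd_set M x -> fd_set M y ->
  (forall m, fd_set M m -> '[x, m] = '[y, m]) -> x = y.
Proof.
move=> Mx My e; apply/subr0_eq/inner_eq0; rewrite innerBl e ?subrr //.
by apply: subspaceB => //; exact: findim_subspace (fd_findim M).
Qed.

Lemma riesz_functional_inj : injective (@riesz_functional R k H).
Proof.
move=> m n e; apply/subr0_eq/inner_eq0; rewrite innerBr.
by rewrite -[X in X - _]/(riesz_functional m _) e /= subrr.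
Qed.

Lemma precomp_linear T g : linear (fun x => g (T x)).
Proof. by move=> a x y; rewrite !linearP. Qed.

Lemma precomp_bounded T g :
  exists C : K, forall x, `|mklin (precomp_linear T g) x| <= C * `|x|.
Proof.
(* The Riesz vector of [g] supplies the bound [|m|], which is known to be nonnegative. *)
have [m ->] := riesz g; have [C TC] := bop_bounded T.
exists (`|m| * C) => x; rewrite (le_trans (cauchy_schwarz _ _)) //.
by rewrite -mulrA ler_wpM2l.
Qed.

Definition precomp T g : bop H K^o := Bop (precomp_bounded T g).

Lemma precomp_is_linear T : linear (precomp T : dual_space H -> dual_space H).
Proof. by move=> a f g; apply: bop_eq => x. Qed.

Definition precomp_lin T : {linear dual_space H -> dual_space H} :=
  mklin (precomp_is_linear T).

(** Since [proj M] is self-adjoint, composing the functional of [m] with it gives the functional of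
    [proj M m]. *)
Lemma dual_subspaceP M g :
  fd_set (dual_subspace M) g <-> forall x, g (proj M x) = g x.
Proof.
split.
  by move=> [m Mm <-] x; rewrite /= proj_inner proj_id.
move=> gP; have [m gE] := riesz g; exists (proj M m); first exact: proj_mem.
by apply: bop_eq => x; rewrite /= -proj_inner -gP gE.
Qed.

(** Products read left to right, so an element of the corner applies [proj N] first and [proj M]
    last. Conversely such a [T] is its own witness, of finite rank because its range lies in [M]. *)
Lemma cornerP M N T : corner (proj N) (proj M) T <->
  (forall x, T (proj N x) = T x) /\ (forall x, fd_set M (T x)).
Proof.
split=> [[A fA <-]|[TN TM]].
  split=> x /=; last exact: proj_mem.
  by rewrite (proj_id (proj_mem N x)).
exists T; first by apply: finite_rank_sub (fd_findim M) _.
by apply: bop_eq => x; rewrite /= TN proj_id.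
Qed.

Lemma dual_subspace_inj : injective (@dual_subspace R k H).
Proof.
have sub M N : dual_subspace M = dual_subspace N -> (fd_set M `<=` fd_set N)%classic.
  move=> e m Mm; have : fd_set (dual_subspace N) (riesz_functional m).
    by rewrite -e; exists m.
  by case=> n Nn /riesz_functional_inj <-.
by move=> M N e; apply: fdsub_eq; apply/seteqP; split; apply: sub.
Qed.

(** The Riesz vectors of a spanning family of [X] span the required [M]; coefficients are conjugated
    because [riesz_functional] is conjugate-linear. *)
Lemma dual_subspace_surj (X : fdsub (dual_space H)) : exists M, dual_subspace M = X.
Proof.
have [n [e eE]] := fd_findim X; have [m mE] := choice (fun i => riesz (e i)).
have Mfd : findim (spanned_by m) by exists n, m.
have -> : X = FdSub (ex_intro _ n (ex_intro _ e (erefl (spanned_by e)))).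
  exact: fdsub_eq.
exists (FdSub Mfd); apply: fdsub_eq; apply/seteqP; split=> [_ /= [_ [c ->] <-]|_ /= [c ->]].
  exists (fun i => conj_scalar (c i)); rewrite riesz_functional_sum.
  by apply: eq_bigr => i _; rewrite mE.
exists (\sum_i conj_scalar (c i) *: m i); first by exists (fun i => conj_scalar (c i)).
by rewrite riesz_functional_sum; apply: eq_bigr => i _; rewrite conj_scalarK mE.
Qed.

Lemma dual_has_projections : has_projections (dual_space H).
Proof.
move=> X; have [M <-] := dual_subspace_surj X; exists (precomp_lin (proj M)).
split=> [g|g /dual_subspaceP gM]; last by apply: bop_eq => x; exact: gM.
by apply/dual_subspaceP => x /=; rewrite (proj_id (proj_mem M x)).
Qed.

Section DualMap.
Variables (M N : fdsub H) (T : bop H H).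
Hypothesis hT : corner (proj N) (proj M) T.

Lemma precomp_corner (g : dual_space H) :
  fd_set (dual_subspace M) g -> fd_set (dual_subspace N) (precomp_lin T g).
Proof.
by have [TN _] := (cornerP M N T).1 hT; move=> _; apply/dual_subspaceP => x /=; rewrite TN.
Qed.

Definition dual_map : {linear dual_subspace M -> dual_subspace N} :=
  fdsub_restrict precomp_corner.

Lemma dual_mapE (g : dual_subspace M) x :
  (val (dual_map g) : bop H K^o) x = (val g : bop H K^o) (T x).
Proof. by []. Qed.

End DualMap.

Definition dual_elt M m (Mm : fd_set M m) : dual_subspace M :=
  @to_fdsub _ _ (dual_subspace M) (riesz_functional m) (ex_intro2 _ _ m Mm erefl).

(** The image of the functional of [m] takes the value ['[T x, m]] at [x], and these values for [m]
    in [M] determine [T x], a vector of [M]. *)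
Lemma dual_map_inj M N T T' (hT : corner (proj N) (proj M) T)
    (hT' : corner (proj N) (proj M) T') : dual_map hT = dual_map hT' -> T = T'.
Proof.
move=> e; apply: bop_eq => x.
have [[_ TM] [_ TM']] := ((cornerP M N T).1 hT, (cornerP M N T').1 hT').
apply: (@fdsub_inner_inj M) => // m Mm.
have := congr1 (fun h : {linear dual_subspace M -> dual_subspace N} =>
  (val (h (dual_elt Mm)) : bop H K^o) x) e.
by [].
Qed.

Lemma bop_sumE (I : Type) (r : seq I) (F : I -> bop H H) x :
  (\sum_(i <- r) F i) x = \sum_(i <- r) F i x.
Proof. exact: (big_morph (fun S : bop H H => S x)). Qed.

Lemma inner_suml (I : Type) (r : seq I) (F : I -> H) y :
  '[\sum_(i <- r) F i, y] = \sum_(i <- r) '[F i, y].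
Proof.
by apply: (big_morph (fun x => '[x, y])) => [u v|]; rewrite ?innerDl ?inner0l.
Qed.

(** Gram-Schmidt induction on a spanning family: removing the last vector [v] leaves the subspace
    [M'], and the projection onto [M] adds to that onto [M'] one dyad along [u], the component of
    [v] orthogonal to [M']. *)
Lemma proj_dyads M : exists s : seq (H * H),
  forall x, proj M x = \sum_(p <- s) '[x, p.1] *: p.2.
Proof.
have [n [e eE]] := fd_findim M; elim: n => [|n IH] in M e eE *.
  exists [::] => x; rewrite big_nil; have := proj_mem M x.
  by rewrite eE spanned0.
pose e' i := e (lift ord_max i); pose v := e ord_max.
pose M' := FdSub (ex_intro _ n (ex_intro _ e' (erefl (spanned_by e')))).
have [s sE] := IH M' e' erefl; pose u := v - proj M' v.
have ME x : fd_set M x <-> exists a y, spanned_by e' y /\ x = y + a *: v.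
  by rewrite eE spanned_recr; exact: spanned_snoc.
have M'M y : fd_set M' y -> fd_set M y.
  by move=> M'y; apply/ME; exists 0, y; rewrite scale0r addr0.
have Mu : fd_set M u.
  apply: subspaceB; first exact: findim_subspace (fd_findim M).
    by rewrite eE; exact: mem_spanned.
  exact/M'M/proj_mem.
exists ((u, `|u| ^- 2 *: u) :: s) => x; rewrite big_cons /= -sE.
have [a [y [M'y xE]]] := (ME _).1 (proj_mem M x).
have PP : proj M' (proj M x) = proj M' x.
  apply: (@fdsub_inner_inj M'); try exact: proj_mem.
  move=> m M'm; rewrite !proj_inner (proj_id M'm).
  by rewrite (proj_id (M'M _ M'm)).
have Pu : proj M' u = 0 by rewrite linearB /= (proj_id (proj_mem M' v)) subrr.
have {}xE : proj M x = a *: u + proj M' x.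
  rewrite -PP xE (linearD (proj M')) [proj M' (a *: v)]linearZ.
  rewrite (proj_id (M'y : fd_set M' y)) /= addrCA.
  by rewrite -scalerDr subrK.
(* Pairing with [u] isolates the coefficient [a], as [u] is orthogonal to [M']. If [u = 0], the new
   dyad vanishes and [a] is irrelevant. *)
have xu : '[x, u] = a * `|u| ^+ 2.
  rewrite -[in LHS](proj_id Mu) -proj_inner xE innerDl innerZl inner_norm.
  by rewrite proj_inner Pu inner0r addr0.
rewrite xE xu scalerA; congr (_ + _); have [->|u0] := eqVneq u 0.
  by rewrite !scaler0.
by rewrite mulfK // expf_neq0 // normr_eq0.
Qed.

Lemma dual_map_surj M N (h : {linear dual_subspace M -> dual_subspace N}) :
  exists T (hT : corner (proj N) (proj M) T), h = dual_map hT.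
Proof.
have [s sE] := proj_dyads M.
have PE y : proj M y = \sum_(p <- s) '[proj M y, p.1] *: proj M p.2.
  transitivity (proj M (proj M (proj M y))); first by rewrite !(proj_id (proj_mem M _)).
  by rewrite (sE (proj M y)) linear_sum; apply: eq_bigr => p _; rewrite linearZ.
pose f v := dual_elt (proj_mem M v).
(* The vector [t v] represents the image under [h] of the functional of [proj M v]; summing the
   dyads from [t p.1] to [proj M p.2] is the only candidate for [T]. *)
have [t tE] := choice (fun v => riesz (val (h (f v)) : bop H K^o)).
pose T := \sum_(p <- s) dyad (t p.1) (proj M p.2).
have TE x m (Mm : fd_set M m) :
    '[T x, m] = (val (h (dual_elt Mm)) : bop H K^o) x.
  (* Transposing the dyadic expansion [PE] of [proj M] expands the functional of [m] in the
     functionals whose images under [h] are known. *)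
  have -> : dual_elt Mm = \sum_(p <- s) '[proj M p.2, m] *: f p.1.
    apply: val_inj; rewrite linear_sum /=; apply: bop_eq => y.
    rewrite (big_morph (fun g : dual_space H => (g : bop H K^o) y)
      (id1 := 0) (op1 := +%R)) //=.
    rewrite -[in LHS](proj_id Mm) -proj_inner PE inner_suml.
    by apply: eq_bigr => p _; rewrite innerZl proj_inner mulrC.
  rewrite linear_sum linear_sum /=.
  rewrite (big_morph (fun g : dual_space H => (g : bop H K^o) x)
    (id1 := 0) (op1 := +%R)) //=.
  rewrite bop_sumE inner_suml; apply: eq_bigr => p _.
  by rewrite linearZ /= innerZl tE mulrC.
have TM x : fd_set M (T x).
  rewrite bop_sumE; apply: subspace_sum (findim_subspace (fd_findim M)) _ => p.
  exact: proj_mem.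
have hT : corner (proj N) (proj M) T.
  (* By [TE], invariance of [T] under [proj N] amounts to the values of [h] lying in the dual
     subspace of [N]. *)
  apply/cornerP; split=> // x; apply: (@fdsub_inner_inj M) => // m Mm.
  by rewrite !TE; apply: (dual_subspaceP N _).1; exact: mem_fdsub.
exists T, hT; apply: linear_eq => g; apply: val_inj; apply: bop_eq => x.
have [m Mm gE] := mem_fdsub g.
have -> : g = dual_elt Mm by apply: val_inj; rewrite -gE.
by rewrite -TE.
Qed.

Lemma opnorm_precomp T g : opnorm (precomp T g) <= opnorm g * opnorm T.
Proof.
apply: opnorm_le => x x1; apply: le_trans (opnorm_apply g (T x)) _.
by rewrite ler_wpM2l ?opnorm_ge0 // opnorm_ub.
Qed.

Lemma opnorm_riesz m : `|m| <= 1 -> opnorm (riesz_functional m) <= 1.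
Proof.
move=> m1; apply: opnorm_le => x x1.
rewrite -[X in _ <= X](real_part_nat R k 1); apply: real_part_le => //.
by apply: le_trans (cauchy_schwarz _ _) _; rewrite mulr_ile1.
Qed.

(** Submultiplicativity gives one inequality. For the other, each [x] with [T x] nonzero is tested
    with the functional of the unit vector [m] along [T x]: it belongs to the domain because [T x]
    is in [M], and it sends [T x] to its norm. *)
Lemma dual_map_norm M N T (hT : corner (proj N) (proj M) T) :
  subspace_hom_norm (dual_map hT) = opnorm T.
Proof.
have ub : (ubound [set r | exists2 g : dual_subspace M,
    opnorm (val g : bop H K^o) <= 1 &
    r = opnorm (val (dual_map hT g) : bop H K^o)] (opnorm T))%classic.
  move=> _ [g g1 ->]; apply: le_trans (opnorm_precomp T (val g)) _.
  by rewrite ler_piMl // opnorm_ge0.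
apply/eqP; rewrite eq_le; apply/andP; split.
  apply: sup_le_ub => //; eexists; exists 0; last reflexivity.
  by apply: opnorm_le => x _; rewrite /= normr0 -[0 : K]/(0%:R) real_part_nat.
apply: opnorm_le => x x1; have [Tx0|Tx0] := eqVneq (T x) 0.
  (* No unit vector is available here; the zero functional shows that the supremum is
     nonnegative. *)
  rewrite Tx0 normr0 -[0 : K]/(0%:R) real_part_nat.
  apply: le_trans (opnorm_ge0 (precomp T 0)) _.
  apply: ub_le_sup; first by exists (opnorm T).
  exists 0 => //; apply: opnorm_le => y _.
  by rewrite /= normr0 -[0 : K]/(0%:R) real_part_nat.
have nTx : `|T x| != 0 by rewrite normr_eq0.
pose m := `|T x|^-1 *: T x.
have m1 : `|m| = 1 by rewrite normrZ normfV normr_id mulVf.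
have Mm : fd_set M m.
  apply: subspaceZ; first exact: findim_subspace (fd_findim M).
  by have [_] := (cornerP _ _ _).1 hT.
have TxE : `|T x| = '[T x, m].
  rewrite innerZr inner_norm conj_scalar_ge0 ?invr_ge0 //.
  by rewrite expr2 mulrA mulVf // mul1r.
apply: (@le_trans _ _ (opnorm (val (dual_map hT (dual_elt Mm)) : bop H K^o))).
  apply: le_trans (opnorm_ub _ x1); rewrite dual_mapE /= -TxE.
  by rewrite normr_id.
apply: ub_le_sup; first by exists (opnorm T).
by exists (dual_elt Mm) => //; apply: opnorm_riesz; rewrite m1.
Qed.

End DualMaps.

(** * The transpose functor on principal right ideals *)

Section DualFunctor.
Variables (R : realType) (k : scalar_kind) (H : hilbertSpace R k).
Local Notation proj := Defs.proj.
Implicit Types (M N : fdsub H) (X Y Z : right_ideal H) (T : bop H H).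

Definition ri_base X : fdsub H := projT1 (cid (proj_ideal_surj X)).

Lemma ri_baseK X : proj_ideal (ri_base X) = X.
Proof. exact/esym/(projT2 (cid (proj_ideal_surj X))). Qed.

Lemma proj_idealK M : ri_base (proj_ideal M) = M.
Proof. by apply: proj_ideal_inj; rewrite ri_baseK. Qed.

(** Replaces the existential subspaces of [is_lambda] by the chosen ones, which coincide with them
    by [proj_ideal_inj]. *)
Lemma ri_coef_spec X Y (f : ri_hom X Y) :
  corner (proj (ri_base Y)) (proj (ri_base X)) (ri_coef f) /\
  forall A : ri_set X, val (f A) = opmul (ri_coef f) (val A).
Proof.
have [M [N [XM YN cT fE]]] := ri_coefP f; split=> //.
have -> : ri_base X = M by apply: proj_ideal_inj; rewrite ri_baseK.
by have -> : ri_base Y = N by apply: proj_ideal_inj; rewrite ri_baseK.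
Qed.

Definition ri_coef_corner X Y (f : ri_hom X Y) := (ri_coef_spec f).1.

Lemma ri_coefE X Y (f : ri_hom X Y) A : val (f A) = opmul (ri_coef f) (val A).
Proof. exact: (ri_coef_spec f).2. Qed.

Lemma ri_coef_uniq X Y (f : ri_hom X Y) T :
  corner (proj (ri_base Y)) (proj (ri_base X)) T ->
  (forall A : ri_set X, val (f A) = opmul T (val A)) -> ri_coef f = T.
Proof.
move=> cT fT; apply: is_lambda_uniq (ri_coefP f) _.
by exists (ri_base X), (ri_base Y); rewrite !ri_baseK.
Qed.

Lemma ri_coef_inj X Y : injective (@ri_coef _ _ _ X Y).
Proof. by move=> f g e; apply: ri_hom_eq => A; rewrite !ri_coefE e. Qed.

Lemma ri_coef_surj X Y T : corner (proj (ri_base Y)) (proj (ri_base X)) T ->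
  exists f : ri_hom X Y, ri_coef f = T.
Proof.
(* An ideal equals [proj_ideal (ri_base X)] only provably, while [lambda] requires that form
   literally. *)
suff gen M N : X = proj_ideal M -> Y = proj_ideal N -> corner (proj N) (proj M) T ->
    exists f : ri_hom X Y, ri_coef f = T by apply: gen; rewrite ri_baseK.
by move=> eX eY cT; subst X Y; exists (lambda cT); exact: lambda_coef.
Qed.

Lemma corner_proj M : corner (proj M) (proj M) (proj M).
Proof.
apply/cornerP; split=> x; last exact: proj_mem.
exact: (proj_id (proj_mem M x)).
Qed.

Lemma ri_coef_id X : ri_coef (ri_id X) = proj (ri_base X).
Proof.
apply: ri_coef_uniq; first exact: corner_proj.
move=> A /=; have := set_mem (valP A); rewrite -{1}(ri_baseK X) => -[B _ <-].
by rewrite opmulA proj_idem.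
Qed.

Lemma ri_coef_comp X Y Z (f : ri_hom X Y) (g : ri_hom Y Z) :
  ri_coef (ri_comp f g) = opmul (ri_coef g) (ri_coef f).
Proof.
apply: ri_coef_uniq; last by move=> A; rewrite /= !ri_coefE opmulA.
have [[_ fM] [gN _]] :=
  ((cornerP _ _ _).1 (ri_coef_corner f), (cornerP _ _ _).1 (ri_coef_corner g)).
by apply/cornerP; split=> x /=; rewrite ?gN.
Qed.

Lemma ri_coef_comb X Y (a : scalars R k) (f g : ri_hom X Y) :
  ri_coef (a *: f + g) = a *: ri_coef f + ri_coef g.
Proof.
apply: ri_coef_uniq.
  by apply: (corner_subspace _ _).2; exact: ri_coef_corner.
by move=> A /=; rewrite scale1r addr0 !ri_coefE opmulDl opmulZl.
Qed.

Definition dual_mor X Y (f : ri_hom X Y) :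
    {linear dual_subspace (ri_base X) -> dual_subspace (ri_base Y)} :=
  dual_map (ri_coef_corner f).

Lemma dual_mor_id X :
  dual_mor (ri_id X) = fdsub_id (dual_subspace (ri_base X)).
Proof.
apply: linear_eq => g; apply: val_inj; apply: bop_eq => x.
rewrite dual_mapE ri_coef_id; apply: (dual_subspaceP _ _).1.
exact: mem_fdsub.
Qed.

(** Covariant because two reversals cancel: left multiplication reverses the order of the operators,
    and so does precomposition. *)
Lemma dual_mor_comp X Y Z (f : ri_hom X Y) (g : ri_hom Y Z) :
  dual_mor (ri_comp f g) = fdsub_comp (dual_mor f) (dual_mor g).
Proof.
apply: linear_eq => h; apply: val_inj; apply: bop_eq => x.
by rewrite dual_mapE ri_coef_comp.
Qed.

Definition dual_functor :
    functor (right_ideal_category H) (subspace_category (dual_space H)) :=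
  @Functor (right_ideal_category H) (subspace_category (dual_space H))
    (fun X => dual_subspace (ri_base X)) dual_mor dual_mor_id dual_mor_comp.

(** Applied to the element [proj (ri_base X)] of [X], an inclusion returns it unchanged, whereas
    multiplying it by the coefficient returns the coefficient. *)
Lemma ri_inclusionP X Y (f : ri_hom X Y) :
  @inclusion (right_ideal_category H) X Y f <-> ri_coef f = proj (ri_base X).
Proof.
split=> [fi|fP A]; last first.
  rewrite ri_coefE fP; have := set_mem (valP A).
  rewrite -{1}(ri_baseK X) => -[B _ <-].
  by rewrite opmulA proj_idem.
have PX : ri_set X (proj (ri_base X)).
  by rewrite -{1}(ri_baseK X); exists (proj (ri_base X));
    [exact: proj_finite_rank|exact: proj_idem].
have := fi (to_set_type PX); rewrite ri_coefE /= => <-.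
have [_ fM] := (cornerP _ _ _).1 (ri_coef_corner f).
by apply: bop_eq => x /=; rewrite (proj_id (fM x)).
Qed.

(** Fixing the functional of every [m] in [M] means that ['[T x, m]] equals ['[x, m]], hence that
    [T x] is the projection of [x]. *)
Lemma dual_inclusionP X Y (f : ri_hom X Y) :
  @inclusion (subspace_category (dual_space H)) _ _ (dual_mor f) <->
  ri_coef f = proj (ri_base X).
Proof.
split=> [fi|fP g]; last first.
  apply: bop_eq => x; rewrite dual_mapE fP.
  exact: ((dual_subspaceP _ _).1 (mem_fdsub g)).
have [_ fM] := (cornerP _ _ _).1 (ri_coef_corner f).
apply: bop_eq => x; apply: (@fdsub_inner_inj _ _ _ (ri_base X)) => //.
  exact: proj_mem.
move=> m Mm; have := congr1 (fun g : bop H _ => g x) (fi (dual_elt Mm)).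
by rewrite dual_mapE /= proj_inner (proj_id Mm).
Qed.

Lemma dual_functor_equivalence : strict_equivalence dual_functor.
Proof.
split.
- by move=> X Y /dual_subspace_inj e; rewrite -(ri_baseK X) -(ri_baseK Y) e.
- move=> D; have [M <-] := dual_subspace_surj D.
  by exists (proj_ideal M); rewrite /= proj_idealK.
- by move=> X Y f g /dual_map_inj /ri_coef_inj.
- move=> X Y h; have [T [hT ->]] := dual_map_surj h.
  have [f fT] := ri_coef_surj hT; exists f; subst T.
  by rewrite /= /dual_mor (Prop_irrelevance hT (ri_coef_corner f)).
- move=> X Y f; apply: iff_trans (ri_inclusionP f) _.
  exact: iff_sym (dual_inclusionP f).
Qed.

Lemma ri_coef_proj_corner M N (f : ri_hom (proj_ideal M) (proj_ideal N)) :
  corner (proj N) (proj M) (ri_coef f).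
Proof. by have := ri_coef_corner f; rewrite !proj_idealK. Qed.

(** The same transpose as [dual_mor], retyped between the subspaces of [M] and [N] themselves, since
    [ri_base (proj_ideal M)] is [M] only provably. *)
Definition dual_hom M N (f : ri_hom (proj_ideal M) (proj_ideal N)) :
    {linear dual_subspace M -> dual_subspace N} :=
  dual_map (ri_coef_proj_corner f).

Lemma dual_hom_linear M N : linear (@dual_hom M N).
Proof.
move=> a f g; apply: linear_eq => h; apply: val_inj; apply: bop_eq => x.
by rewrite dual_mapE ri_coef_comb linearP.
Qed.

Lemma dual_hom_bijective M N : bijective (@dual_hom M N).
Proof.
have inj : injective (@dual_hom M N) by move=> f g /dual_map_inj /ri_coef_inj.
have surj h : exists f, @dual_hom M N f = h.
  have [T [hT ->]] := dual_map_surj h; exists (lambda hT).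
  have := ri_coef_proj_corner (lambda hT); rewrite /dual_hom.
  (* The membership proof mentions the coefficient, so it is generalised before the coefficient is
     rewritten to [T]. *)
  move: (ri_coef_proj_corner _); rewrite lambda_coef => c _.
  by rewrite (Prop_irrelevance c hT).
have [g gK] := choice surj.
by exists g => // f; apply: inj; rewrite gK.
Qed.

Lemma dual_mor_Arrow M N (f : ri_hom (proj_ideal M) (proj_ideal N)) :
  Arrow (@functor_mor _ _ dual_functor (proj_ideal M) (proj_ideal N) f) =
  @Arrow (subspace_category (dual_space H)) _ _ (dual_hom f).
Proof.
apply: subspace_Arrow_eq => [||g g' e]; try by rewrite /= proj_idealK.
by apply: bop_eq => x; rewrite !dual_mapE e.
Qed.

End DualFunctor.

Theorem theorem4p3 (R : realType) (k : scalar_kind) (H : hilbertSpace R k) :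
  is_normal_category (right_ideal_category H) /\
  is_normal_category (subspace_category (dual_space H)) /\
  exists F : inclusion_isomorphism
               (right_ideal_category H) (subspace_category (dual_space H)),
    (forall M : fdsub H, F (proj_ideal M) = dual_subspace M) /\
    forall M N : fdsub H,
      exists phi : ri_hom (proj_ideal M) (proj_ideal N) ->
                   {linear dual_subspace M -> dual_subspace N},
        [/\ forall f,
               Arrow (@functor_mor _ _ F (proj_ideal M) (proj_ideal N) f) =
               @Arrow (subspace_category (dual_space H)) _ _ (phi f),
            linear phi,
            bijective phi &
            forall f, subspace_hom_norm (phi f) = ri_norm f].
Proof.
have FE := dual_functor_equivalence H.
have DN := subspace_normal_category (@dual_has_projections _ _ H).
split; first exact: reflect_normal_category FE DN.
split=> //; exists (strict_equivalence_isomorphism FE); split.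
  by move=> M; rewrite /= proj_idealK.
move=> M N; exists (@dual_hom _ _ H M N); split.
- exact: dual_mor_Arrow.
- exact: dual_hom_linear.
- exact: dual_hom_bijective.
- by move=> f; exact: dual_map_norm.
Qed.
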